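(* As formal power series in $q$ with coefficients Laurent polynomials in $z$, the following identities hold: \begin{align*} &(1+z)(z,z^{-1};q)_\infty S_{A1}(z,q)=\frac{1}{(q;q)_\infty}\sum_{k=1}^\infty(1-z^{k-1})(1-z^k)z^{1-k}\Big((-1)^{k+1}q^{k(k-1)/2}+\sum_{n=1}^\infty(-1)^{n+k+1}q^{\frac{k(k-1)}{2}+\frac{n(n-3)}{2}+2kn}(1+q^n)\Big),\\ &(1+z)(z,z^{-1};q)_\infty S_{A3}(z,q)=\frac{1}{(q;q)_\infty}\sum_{k=1}^\infty\sum_{n=0}^\infty(1-z^{k-1})(1-z^k)z^{1-k}(-1)^{n+k+1}q^{\frac{k(k+1)}{2}+\frac{n(n-3)}{2}+2kn-1}(1-q^{2n+1}),\\ &(1+z)(z,z^{-1};q)_\infty S_{A5}(z,q)=\sum_{k=-\infty}^\infty(-1)^k(1-z^k)(1-z^{k+1})z^{-k}q^{\frac{k(3k+1)}{2}},\\ &(1+z)(z,z^{-1};q)_\infty S_{A7}(z,q)=\sum_{k=-\infty}^\infty(-1)^k(1-z^k)(1-z^{k+1})z^{-k}q^{\frac{k(3k-1)}{2}},\\ &(1+z)(z,z^{-1};q)_\infty S_{C1}(z,q)=\frac{1}{(q;q)_\infty}\sum_{k=1}^\infty\sum_{n=0}^\infty(1-z^{k-1})(1-z^k)z^{1-k}(-1)^{k+1}q^{\frac{k(k-1)}{2}+\frac{n(3n-1)}{2}+3kn}(1-q^{2k-1})(1-q^{k+n}),\\ &(1+z)(z,z^{-1};q)_\infty S_{C5}(z,q)=\sum_{k=-\infty}^\infty(1-z^{k-1})(1-z^k)z^{1-k}(-1)^kq^{k^2},\\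 &(1+z)(z,z^{-1};q)_\infty S_{E2}(z,q)=(q;q^2)_\infty\sum_{k=1}^\infty(1-z^k)(1-z^{k-1})z^{1-k}q^{\frac{k(k-1)}{2}},\\ &(1+z)(z,z^{-1};q)_\infty S_{E4}(z,q)=\frac{1}{(q;q)_\infty}\sum_{k=1}^\infty\sum_{n=0}^\infty(1-z^{k-1})(1-z^k)z^{1-k}(-1)^{k+n+1}q^{\frac{k(k+1)}{2}+n^2-n+2kn-1}(1-q^{2n+1}). \end{align*}
   Context: Notation: $(a;q)_n=\prod_{j=0}^{n-1}(1-aq^j)$, $(a;q)_\infty=\prod_{j\ge0}(1-aq^j)$, $(a_1,\dots,a_k;q)_\infty=(a_1;q)_\infty\cdots(a_k;q)_\infty$. Define \begin{align*} S_{A1}(z,q)&=\sum_{n\ge1}\frac{q^n(q^{2n+1};q)_\infty}{(zq^n,z^{-1}q^n;q)_\infty},& S_{A3}(z,q)&=\sum_{n\ge1}\frac{q^{2n}(q^{2n+1};q)_\infty}{(zq^n,z^{-1}q^n;q)_\infty},\\ S_{A5}(z,q)&=\sum_{n\ge1}\frac{q^{n^2+n}(q^{2n+1};q)_\infty}{(zq^n,z^{-1}q^n;q)_\infty},& S_{A7}(z,q)&=\sum_{n\ge1}\frac{q^{n^2}(q^{2n+1};q)_\infty}{(zq^n,z^{-1}q^n;q)_\infty},\\ S_{C1}(z,q)&=\sum_{n\ge1}\frac{q^n(q^{2n+1};q^2)_\infty(q^{n+1};q)_\infty}{(zq^n,z^{-1}q^n;q)_\infty},& S_{C5}(z,q)&=\sum_{n\ge1}\frac{q^{(n^2+n)/2}(q^{2n+1};q^2)_\infty(q^{n+1};q)_\infty}{(zq^n,z^{-1}q^n;q)_\infty},\\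 S_{E2}(z,q)&=\sum_{n\ge1}\frac{(-1)^nq^n(q^{2n+2};q^2)_\infty}{(zq^n,z^{-1}q^n;q)_\infty},& S_{E4}(z,q)&=\sum_{n\ge1}\frac{q^{2n}(q^{2n+2};q^2)_\infty}{(zq^n,z^{-1}q^n;q)_\infty}. \end{align*} *)

(* Defs.v *)
From HB Require Import structures.
From mathcomp Require Import all_boot all_order all_algebra.
From mathcomp Require Import boolp classical_sets cardinality fsbigop.

Set Implicit Arguments.
Unset Strict Implicit.
Unset Printing Implicit Defensive.

Import Order.TTheory GRing.Theory Num.Theory.

Local Open Scope ring_scope.

Local Notation "x %:F" := (@FracField.tofrac _ x).

(** * The ring Z[z, z^-1] of Laurent polynomials

    It is the subring of the fraction field of Z[z] formed by the p / z^n. *)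

Definition is_laurent : pred {fraction {poly int}} := fun x =>
  `[< exists (p : {poly int}) (n : nat), x = p%:F / 'X%:F ^+ n >].

Lemma is_laurentP x :
  reflect (exists (p : {poly int}) (n : nat), x = p%:F / 'X%:F ^+ n)
          (x \in is_laurent).
Proof. exact: asboolP. Qed.

Lemma fracX_neq0 : ('X : {poly int})%:F != 0.
Proof. by rewrite tofrac_eq0 polyX_eq0. Qed.

Lemma is_laurent_tofrac p : p%:F \in is_laurent.
Proof. by apply/is_laurentP; exists p, 0; rewrite expr0 divr1. Qed.

Lemma is_laurent_subring : subring_closed is_laurent.
Proof.
have X0 n : ('X : {poly int})%:F ^+ n != 0 by rewrite expf_neq0 ?fracX_neq0.
split.
- by rewrite -tofrac1; exact: is_laurent_tofrac.
- move=> _ _ /is_laurentP[p [m ->]] /is_laurentP[r [n ->]]; apply/is_laurentP.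
  exists (p * 'X^n - r * 'X^m), (m + n)%N.
  by rewrite -mulNr addf_div// mulNr exprD tofracB !tofracM !tofracXn.
- move=> _ _ /is_laurentP[p [m ->]] /is_laurentP[r [n ->]]; apply/is_laurentP.
  by exists (p * r), (m + n)%N; rewrite exprD tofracM invfM mulrACA.
Qed.

HB.instance Definition _ :=
  GRing.isSubringClosed.Build {fraction {poly int}} is_laurent
    is_laurent_subring.

Record laurent := Laurent {
  laurent_val : {fraction {poly int}};
  _ : laurent_val \in is_laurent }.

HB.instance Definition _ := [isSub for laurent_val].
HB.instance Definition _ := [Choice of laurent by <:].
HB.instance Definition _ := [SubChoice_isSubComNzRing of laurent by <:].

Definition laurent_unit : pred laurent :=
  fun x => (x != 0) && ((val x)^-1 \in is_laurent).
Definition laurent_inv (x : laurent) : laurent := insubd x (val x)^-1.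

Lemma laurent_val0 : laurent_val 0 = 0.
Proof. exact: (rmorph0 (val : laurent -> _)). Qed.
Lemma laurent_val1 : laurent_val 1 = 1.
Proof. exact: (rmorph1 (val : laurent -> _)). Qed.
Lemma laurent_valM x y : laurent_val (x * y) = laurent_val x * laurent_val y.
Proof. exact: (rmorphM (val : laurent -> _)). Qed.
Lemma laurent_val_inj : injective laurent_val.
Proof. exact: val_inj. Qed.
Lemma laurent_val_eq0 x : (laurent_val x == 0) = (x == 0).
Proof. by rewrite -laurent_val0 (inj_eq laurent_val_inj). Qed.
Lemma laurent_valV x : (laurent_val x)^-1 \in is_laurent ->
  laurent_val (laurent_inv x) = (laurent_val x)^-1.
Proof. by move=> xV; rewrite /laurent_inv /insubd insubT. Qed.

Lemma laurent_mulVr : {in laurent_unit, left_inverse 1 laurent_inv *%R}.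
Proof.
move=> x /andP[x0 xV]; apply: laurent_val_inj.
rewrite laurent_valM.
rewrite (laurent_valV xV).
rewrite laurent_val1.
apply: mulVf.
by rewrite laurent_val_eq0.
Qed.

Lemma laurent_unitPl x y : y * x = 1 -> laurent_unit x.
Proof.
move=> yx1; have := congr1 laurent_val yx1.
rewrite laurent_valM laurent_val1 => vyx.
have x0 : laurent_val x != 0.
  apply/eqP => vx0; move: vyx; rewrite vx0 mulr0 => /esym/eqP.
  by rewrite oner_eq0.
apply/andP; split; first by rewrite -laurent_val_eq0.
have -> : (val x)^-1 = laurent_val y by rewrite -[RHS](mulfK x0) vyx div1r.
by case: (y).
Qed.

Lemma laurent_inv_out : {in [predC laurent_unit], laurent_inv =1 id}.
Proof.
move=> x xN; apply: laurent_val_inj.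
have [xV|xV] := boolP ((laurent_val x)^-1 \in is_laurent); last first.
  by rewrite /laurent_inv /insubd insubN.
have /eqP x0 : x == 0.
  by apply: contraNT xN => x0; apply/andP; split.
by rewrite laurent_valV// x0 laurent_val0 invr0.
Qed.

HB.instance Definition _ := GRing.ComNzRing_hasMulInverse.Build laurent
  laurent_mulVr laurent_unitPl laurent_inv_out.

Definition laurentX : laurent := Laurent (is_laurent_tofrac 'X).

Lemma laurentX_unit : laurentX \is a GRing.unit.
Proof.
apply/andP; split; first by rewrite -laurent_val_eq0 fracX_neq0.
by apply/is_laurentP; exists 1, 1; rewrite tofrac1 div1r expr1.
Qed.

(** * Formal power series *)

Record fps (R : Type) := Fps { fps_coef :> nat -> R }.

Lemma fpsP (R : Type) (f g : fps R) : f =1 g <-> f = g.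
Proof.
split=> [|-> //]; case: f => f; case: g => g /= fg.
by congr Fps; apply/funext.
Qed.

HB.instance Definition _ (R : Type) := gen_eqMixin (fps R).
HB.instance Definition _ (R : Type) := gen_choiceMixin (fps R).

Section FpsRing.
Variable R : comNzRingType.
Implicit Types f g h : fps R.

Definition fps_const (c : R) : fps R := Fps (fun n => if n == 0%N then c else 0).
Definition fpsX : fps R := Fps (fun n => (n == 1%N)%:R).

Definition fps_add f g : fps R := Fps (fun n => f n + g n).
Definition fps_opp f : fps R := Fps (fun n => - f n).
Definition fps_mul f g : fps R :=
  Fps (fun n => \sum_(i < n.+1) f i * g (n - i)%N).

Definition fps_trunc (n : nat) f : {poly R} := \poly_(i < n.+1) f i.

Lemma coef_fps_trunc n f i : (i <= n)%N -> (fps_trunc n f)`_i = f i.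
Proof. by rewrite coef_poly ltnS => ->. Qed.

Lemma fps_mulE n f g (p r : {poly R}) : (forall i, (i <= n)%N -> p`_i = f i) ->
  (forall i, (i <= n)%N -> r`_i = g i) -> fps_mul f g n = (p * r)`_n.
Proof.
move=> pf rg; rewrite coefM; apply: eq_bigr => i _ /=.
by rewrite pf ?rg ?leq_subr// -ltnS.
Qed.

Lemma coef_fps_truncM n f g i : (i <= n)%N ->
  (fps_trunc n f * fps_trunc n g)`_i = fps_mul f g i.
Proof.
by move=> lein; apply/esym/fps_mulE => j leji;
  rewrite coef_fps_trunc// (leq_trans leji).
Qed.

Lemma fps_addA : associative fps_add.
Proof. by move=> f g h; apply/fpsP => n /=; rewrite addrA. Qed.
Lemma fps_addC : commutative fps_add.
Proof. by move=> f g; apply/fpsP => n /=; rewrite addrC. Qed.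
Lemma fps_add0 : left_id (fps_const 0) fps_add.
Proof. by move=> f; apply/fpsP => n /=; rewrite if_same add0r. Qed.
Lemma fps_addN : left_inverse (fps_const 0) fps_opp fps_add.
Proof. by move=> f; apply/fpsP => n /=; rewrite if_same addNr. Qed.

HB.instance Definition _ :=
  GRing.isZmodule.Build (fps R) fps_addA fps_addC fps_add0 fps_addN.

Lemma fps_mulA : associative fps_mul.
Proof.
move=> f g h; apply/fpsP => n.
rewrite (@fps_mulE n _ _ (fps_trunc n f) (fps_trunc n g * fps_trunc n h)).
- rewrite mulrA; apply/esym/fps_mulE => i lein; first exact: coef_fps_truncM.
  exact: coef_fps_trunc.
- by move=> i; exact: coef_fps_trunc.
- by move=> i; exact: coef_fps_truncM.
Qed.

Lemma fps_mulC : commutative fps_mul.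
Proof.
move=> f g; apply/fpsP => n.
by rewrite -!(@coef_fps_truncM n)// mulrC.
Qed.

Lemma fps_mul1 : left_id (fps_const 1) fps_mul.
Proof.
move=> f; apply/fpsP => n /=.
rewrite big_ord_recl /= mul1r subn0 big1 ?addr0// => i _.
by rewrite mul0r.
Qed.

Lemma fps_mulDl : left_distributive fps_mul fps_add.
Proof.
move=> f g h; apply/fpsP => n /=.
by rewrite -big_split; apply: eq_bigr => i _; rewrite mulrDl.
Qed.

Lemma fps_one_neq0 : fps_const 1 != 0.
Proof. by apply/eqP => /fpsP /(_ 0) /= /eqP; rewrite oner_eq0. Qed.

HB.instance Definition _ := GRing.Zmodule_isComNzRing.Build (fps R)
  fps_mulA fps_mulC fps_mul1 fps_mulDl fps_one_neq0.

Lemma coef_fpsM f g n : (f * g) n = \sum_(i < n.+1) f i * g (n - i)%N.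
Proof. by []. Qed.

(** The [n]-th coefficient of the limit is the value at which the [n]-th
    coefficients of [u] stabilise. *)
Definition fps_lim (u : nat -> fps R) : fps R :=
  Fps (fun n => xget 0 [set c | exists M, forall m, (M <= m)%N -> u m n = c]%classic).

Lemma fps_limE (u : nat -> fps R) n M :
  (forall m, (M <= m)%N -> u m n = u M n) -> fps_lim u n = u M n.
Proof.
move=> uM; apply: xget_unique => /=; first by exists M.
move=> c [K uK].
by rewrite -(uK (maxn K M)) ?leq_maxl// uM// leq_maxr.
Qed.

(** Coefficientwise sum of a family indexed by [D]; each coefficient has to be
    nonzero for finitely many indices only. *)
Definition fps_sum (I : choiceType) (D : set I) (F : I -> fps R) : fps R :=
  Fps (fun n => \sum_(i \in D) F i n).

End FpsRing.

Section FpsUnit.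
Variable R : comUnitRingType.
Implicit Types f g : fps R.

(** The first [n.+1] coefficients of the inverse of [f], from the recurrence
    [f 0 * g n = - \sum_(i < n) f (n - i) * g i]. *)
Fixpoint fps_inv_seq f (n : nat) : seq R :=
  if n is m.+1 then
    let s := fps_inv_seq f m in
    rcons s (- (f 0%N)^-1 * \sum_(i < n) f (n - i)%N * s`_i)
  else [:: (f 0%N)^-1].

Definition fps_unit : pred (fps R) := fun f => f 0%N \is a GRing.unit.
Definition fps_inv f : fps R :=
  if fps_unit f then Fps (fun n => (fps_inv_seq f n)`_n) else f.

Lemma size_fps_inv_seq f n : size (fps_inv_seq f n) = n.+1.
Proof. by elim: n => //= n IHn; rewrite size_rcons IHn. Qed.

Lemma nth_fps_inv_seq f n i : (i <= n)%N ->
  (fps_inv_seq f n)`_i = (fps_inv_seq f i)`_i.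
Proof.
elim: n => [|n IHn]; first by rewrite leqn0 => /eqP ->.
rewrite leq_eqVlt => /orP[/eqP -> //|lein].
by rewrite /= nth_rcons size_fps_inv_seq lein IHn.
Qed.

Lemma fps_mulVr : {in fps_unit, left_inverse 1 fps_inv *%R}.
Proof.
move=> f fU; apply/fpsP => -[|n]; rewrite coef_fpsM.
  by rewrite big_ord1 /fps_inv ifT//= mulVr.
rewrite big_ord_recr /= /fps_inv ifT//= nth_rcons size_fps_inv_seq ltnn eqxx.
rewrite subnn mulrAC mulNr mulVr// mulN1r.
apply/eqP; rewrite subr_eq0; apply/eqP/eq_bigr => i _.
have lein : (i <= n)%N by rewrite -ltnS.
by rewrite mulrC (nth_fps_inv_seq f lein).
Qed.

Lemma fps_unitPl f g : g * f = 1 -> fps_unit f.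
Proof.
move=> /fpsP /(_ 0%N); rewrite coef_fpsM big_ord1 subnn => gf1.
by apply/unitrP; exists (g 0%N); split=> //; rewrite mulrC.
Qed.

Lemma fps_inv_out : {in [predC fps_unit], fps_inv =1 id}.
Proof. by move=> f /= fN; rewrite /fps_inv ifN. Qed.

HB.instance Definition _ := GRing.ComNzRing_hasMulInverse.Build (fps R)
  fps_mulVr fps_unitPl fps_inv_out.

End FpsUnit.

Reserved Notation "\fsum_ ( i '\in' D ) F"
  (at level 41, F at level 41, i, D at level 60,
   format "'[' \fsum_ ( i  '\in'  D ) '/  '  F ']'").
Notation "\fsum_ ( i '\in' D ) F" := (fps_sum D%classic (fun i => F)) : ring_scope.

(** * q-Pochhammer symbols and the series S(z, q) *)

Section QSeries.
Variable R : comUnitRingType.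
Implicit Types a b z q : fps R.

Definition qpoch a q (n : nat) : fps R := \prod_(j < n) (1 - a * q ^+ j).
Definition qpoch_inf a q : fps R := fps_lim (qpoch a q).
Definition qpoch2_inf a b q : fps R := qpoch_inf a q * qpoch_inf b q.

Lemma coef_fpsX_lt q (j i : nat) : q 0%N = 0 -> (i < j)%N -> (q ^+ j) i = 0.
Proof.
move=> q0; elim: j i => // j IHj i; rewrite ltnS => leij.
rewrite exprS coef_fpsM big1// => -[[|l] /= ltl] _; first by rewrite q0 mul0r.
rewrite IHj ?mulr0// (leq_trans _ leij)// ltn_subrL /=.
exact: leq_ltn_trans (leq0n l) ltl.
Qed.

Lemma qpoch_infE a q (n : nat) : q 0%N = 0 -> qpoch_inf a q n = qpoch a q n.+1 n.
Proof.
move=> q0; apply: fps_limE => m; elim: m => // m IHm.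
rewrite leq_eqVlt => /orP[/eqP <- //|ltnm]; rewrite -IHm//.
have -> : qpoch a q m.+1 = qpoch a q m - qpoch a q m * a * q ^+ m.
  by rewrite /qpoch big_ord_recr /= mulrBr mulr1 mulrA.
suff qm0 : (qpoch a q m * a * q ^+ m) n = 0.
  by rewrite -[RHS]subr0 -qm0.
rewrite coef_fpsM big1// => i _.
by rewrite coef_fpsX_lt ?mulr0// (leq_ltn_trans (leq_subr _ _)).
Qed.

Definition S_A1 z q : fps R := \fsum_(n \in [set n | (1 <= n)%N])
  (q ^+ n * qpoch_inf (q ^+ (2 * n + 1)) q
   / qpoch2_inf (z * q ^+ n) (z^-1 * q ^+ n) q).

Definition S_A3 z q : fps R := \fsum_(n \in [set n | (1 <= n)%N])
  (q ^+ (2 * n) * qpoch_inf (q ^+ (2 * n + 1)) q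
   / qpoch2_inf (z * q ^+ n) (z^-1 * q ^+ n) q).

Definition S_A5 z q : fps R := \fsum_(n \in [set n | (1 <= n)%N])
  (q ^+ (n ^ 2 + n) * qpoch_inf (q ^+ (2 * n + 1)) q
   / qpoch2_inf (z * q ^+ n) (z^-1 * q ^+ n) q).

Definition S_A7 z q : fps R := \fsum_(n \in [set n | (1 <= n)%N])
  (q ^+ (n ^ 2) * qpoch_inf (q ^+ (2 * n + 1)) q
   / qpoch2_inf (z * q ^+ n) (z^-1 * q ^+ n) q).

Definition S_C1 z q : fps R := \fsum_(n \in [set n | (1 <= n)%N])
  (q ^+ n * qpoch_inf (q ^+ (2 * n + 1)) (q ^+ 2) * qpoch_inf (q ^+ (n + 1)) q
   / qpoch2_inf (z * q ^+ n) (z^-1 * q ^+ n) q).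

Definition S_C5 z q : fps R := \fsum_(n \in [set n | (1 <= n)%N])
  (q ^+ ((n ^ 2 + n) %/ 2)
   * qpoch_inf (q ^+ (2 * n + 1)) (q ^+ 2) * qpoch_inf (q ^+ (n + 1)) q
   / qpoch2_inf (z * q ^+ n) (z^-1 * q ^+ n) q).

Definition S_E2 z q : fps R := \fsum_(n \in [set n | (1 <= n)%N])
  ((-1) ^+ n * q ^+ n * qpoch_inf (q ^+ (2 * n + 2)) (q ^+ 2)
   / qpoch2_inf (z * q ^+ n) (z^-1 * q ^+ n) q).

Definition S_E4 z q : fps R := \fsum_(n \in [set n | (1 <= n)%N])
  (q ^+ (2 * n) * qpoch_inf (q ^+ (2 * n + 2)) (q ^+ 2)
   / qpoch2_inf (z * q ^+ n) (z^-1 * q ^+ n) q).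

End QSeries.

(** The integer powers of [qser] used have nonnegative exponents: the
    variable of a power series ring is not a unit. *)
Definition zser : fps laurent := fps_const laurentX.
Definition qser : fps laurent := fpsX laurent.

Lemma zser_unit : zser \is a GRing.unit.
Proof. exact: laurentX_unit. Qed.

(* Main.v *)
(* By the finite Jacobi triple product, (1 + z) (z;q)_n (1/z;q)_n is a combination of
   the zfactor z r = (1 - z^r) (1 - z^(r+1)) z^(-r), 0 <= r <= n, whose coefficients
     (-1)^r q^(r(r-1)/2) (1 - q^(2r+1)) (q;q)_(2n) / ((q;q)_(n-r) (q;q)_(n+r+1))
   do not depend on z. Since (z, 1/z;q)_oo / (z q^n, q^n/z;q)_oo = (z, 1/z;q)_n, each of
   the left-hand sides becomes a sum over r = k - 1 of zfactor z r times a series in q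
   alone (a conjugate Bailey pair relative to q). Each of these series, as a function of
   r, either is constant or satisfies a first-order recurrence with coefficients of
   positive order, and so does the expected value. The recurrences are proved by
   telescoping (creative telescoping provides the closed forms of the partial sums). *)
Require Import Defs.
From HB Require Import structures.
From mathcomp Require Import all_boot all_order all_algebra.
From mathcomp Require Import boolp classical_sets cardinality fsbigop.
From mathcomp Require Import ring zify.

Set Implicit Arguments.
Unset Strict Implicit.
Unset Printing Implicit Defensive.

Import Order.TTheory GRing.Theory Num.Theory.

Local Open Scope ring_scope.

(** * Orders, congruences modulo powers of q, and infinite sums of power series *)

Section Series.
Variable R : comUnitRingType.
Implicit Types (f g h : fps R) (u v : nat -> fps R).

(** The inner series are tractable because the factor [(q;q)_(2n)] of the coefficients, whole or
    split as [(q;q^2)_n (q^2;q^2)_n], completes the tail [(q^(2n+1);q)_oo], [(q^(2n+1);q^2)_oo] or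
    [(q^(2n+2);q^2)_oo] of the n-th summand to an infinite product free of n. What remains is a
    basic hypergeometric sum over m = n - r.

    The factor [zfactor z r] is w_r - w_0 with w_r = z^(r+1) + z^(-r). Subtracting w_0 is free for n
    >= 1: the coefficients sum to 0, since (z, 1/z; q)_n vanishes at z = 1.

    A first-order recurrence whose coefficient has positive order determines the sequence by itself.
    A sequence that is constant in r must instead be evaluated as r tends to infinity. Two cases are
    indirect: A3 is reduced to the series of A1 by a contiguous relation, and A7 to that of A5 by
    splitting a power of q.

    Limits are congruences modulo q^n throughout. The telescoping steps become polynomial identities
    once all inverse Pochhammer symbols are raised to a common index. Everything holds for a unit z
    over any commutative ring with units. *)

Definition fps_ord_ge n f := forall i, (i < n)%N -> f i = 0.

Lemma fps_coefD f g i : (f + g) i = f i + g i. Proof. by []. Qed.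
Lemma fps_coefB f g i : (f - g) i = f i - g i. Proof. by []. Qed.
Lemma fps_coef0 i : (0 : fps R) i = 0. Proof. by rewrite /= if_same. Qed.

Lemma fps_coef_sum (I : Type) (s : seq I) (P : pred I) (F : I -> fps R) i :
  (\sum_(j <- s | P j) F j) i = \sum_(j <- s | P j) F j i.
Proof. exact: (big_morph (fun f : fps R => f i) (fun f g => erefl) (fps_coef0 i)). Qed.

Lemma ord_geW m n f : (m <= n)%N -> fps_ord_ge n f -> fps_ord_ge m f.
Proof. by move=> lemn f0 i ltim; apply: f0; exact: leq_trans lemn. Qed.

Lemma ord_geM m n f g : fps_ord_ge m f -> fps_ord_ge n g -> fps_ord_ge (m + n) (f * g).
Proof.
move=> f0 g0 i lti; rewrite coef_fpsM big1// => -[j /= ltj] _.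
have [ltjm|lemj] := ltnP j m; first by rewrite f0 ?mul0r.
by rewrite g0 ?mulr0//; lia.
Qed.

Lemma ord_geMl n f g : fps_ord_ge n f -> fps_ord_ge n (f * g).
Proof. by rewrite -{2}(addn0 n) => f0; exact: ord_geM. Qed.

Lemma ord_geMr n f g : fps_ord_ge n g -> fps_ord_ge n (f * g).
Proof. by rewrite mulrC; exact: ord_geMl. Qed.

Lemma ord_geD n f g : fps_ord_ge n f -> fps_ord_ge n g -> fps_ord_ge n (f + g).
Proof. by move=> f0 g0 i lti; rewrite fps_coefD f0 ?g0 ?addr0. Qed.

Lemma ord_geN n f : fps_ord_ge n f -> fps_ord_ge n (- f).
Proof. by move=> f0 i lti; rewrite -sub0r fps_coefB fps_coef0 f0 ?subr0. Qed.

Lemma ord_ge_X n : fps_ord_ge n (fpsX R ^+ n).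
Proof. by move=> i; exact: coef_fpsX_lt. Qed.

Lemma ord_ge_Xle m n : (m <= n)%N -> fps_ord_ge m (fpsX R ^+ n).
Proof. by move=> lemn; apply: ord_geW lemn _; exact: ord_ge_X. Qed.

Lemma ord_ge_sum (I : Type) (s : seq I) (P : pred I) (F : I -> fps R) n :
  (forall j, P j -> fps_ord_ge n (F j)) -> fps_ord_ge n (\sum_(j <- s | P j) F j).
Proof. by move=> F0 i lti; rewrite fps_coef_sum big1// => j Pj; exact: F0. Qed.

Lemma ord_ge_eq0 f : (forall n, fps_ord_ge n f) -> f = 0.
Proof. by move=> f0; apply/fpsP => i; rewrite fps_coef0 (f0 i.+1). Qed.

Definition fps_eqmod n f g := fps_ord_ge n (f - g).

Lemma eqmodP f g : (forall n, fps_eqmod n f g) -> f = g.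
Proof. by move=> fg; apply/eqP; rewrite -subr_eq0; apply/eqP/ord_ge_eq0. Qed.

Lemma eqmodW m n f g : (m <= n)%N -> fps_eqmod n f g -> fps_eqmod m f g.
Proof. exact: ord_geW. Qed.

Lemma eqmod_refl n f : fps_eqmod n f f.
Proof. by move=> i _; rewrite subrr fps_coef0. Qed.

Lemma eqmod_sym n f g : fps_eqmod n f g -> fps_eqmod n g f.
Proof. by move=> /ord_geN; rewrite opprB. Qed.

Lemma eqmod_trans n g f h : fps_eqmod n f g -> fps_eqmod n g h -> fps_eqmod n f h.
Proof. by move=> fg gh; have := ord_geD fg gh; rewrite addrA subrK. Qed.

Lemma eqmodD n f g f' g' :
  fps_eqmod n f f' -> fps_eqmod n g g' -> fps_eqmod n (f + g) (f' + g').
Proof. by move=> ff gg; have := ord_geD ff gg; rewrite /fps_eqmod addrACA opprD. Qed.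

Lemma eqmodM n f g f' g' :
  fps_eqmod n f f' -> fps_eqmod n g g' -> fps_eqmod n (f * g) (f' * g').
Proof.
move=> ff gg; rewrite /fps_eqmod.
have -> : f * g - f' * g' = (f - f') * g + f' * (g - g') by ring.
by apply: ord_geD; [exact: ord_geMl | exact: ord_geMr].
Qed.

Lemma fps_unitE f : (f \is a GRing.unit) = (f 0%N \is a GRing.unit).
Proof. by []. Qed.

Lemma fps_coef0M f g : (f * g) 0%N = f 0%N * g 0%N.
Proof. by rewrite coef_fpsM big_ord1. Qed.

Lemma eqmodV n f g : f \is a GRing.unit -> g \is a GRing.unit ->
  fps_eqmod n f g -> fps_eqmod n f^-1 g^-1.
Proof.
move=> fU gU fg; rewrite /fps_eqmod.
have -> : f^-1 - g^-1 = (g - f) * (f^-1 * g^-1).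
  by rewrite mulrBl mulrCA divrr// mulr1 mulrA divrr// mul1r.
by apply: ord_geMl; exact: eqmod_sym.
Qed.

(** Coefficient n is read off the first n.+1 terms. For a [small] sequence the later terms cannot
    contribute to it, so this is the infinite sum, without any limit. *)
Definition ser u : fps R := Fps (fun n => (\sum_(i < n.+1) u i) n).
Definition small u := forall n, fps_ord_ge n (u n).

Lemma eq_ser u v : (forall n, u n = v n) -> ser u = ser v.
Proof. by move=> uv; congr ser; apply/funext. Qed.

Lemma serD u v : ser (fun n => u n + v n) = ser u + ser v.
Proof. by apply/fpsP => n; rewrite /= big_split. Qed.

Lemma ser_eqmod u n M : small u -> (n <= M)%N -> fps_eqmod n (ser u) (\sum_(i < M) u i).
Proof.
move=> u0 lenM i lti; rewrite fps_coefB /= !fps_coef_sum.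
rewrite -(big_mkord xpredT (fun j => u j i)) -(big_mkord xpredT (fun j => u j i)).
rewrite (@big_cat_nat _ _ _ i.+1 0 M)//=; last by lia.
rewrite opprD addrA subrr sub0r big_nat big1 ?oppr0// => j /andP[ltij _].
exact: u0.
Qed.

Lemma serMl c u : small u -> c * ser u = ser (fun n => c * u n).
Proof.
move=> u0; apply: eqmodP => n.
apply: (@eqmod_trans _ (c * \sum_(i < n) u i)).
  by apply: eqmodM; [exact: eqmod_refl | exact: ser_eqmod].
apply: eqmod_sym; rewrite mulr_sumr; apply: ser_eqmod => // m.
by apply: ord_geMr; exact: u0.
Qed.

Lemma ser_recl u : small u -> ser u = u 0%N + ser (fun n => u n.+1).
Proof.
move=> u0; apply: eqmodP => n.
apply: (@eqmod_trans _ (\sum_(i < n.+1) u i)); first exact: ser_eqmod.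
rewrite big_ord_recl; apply: eqmodD; first exact: eqmod_refl.
apply: eqmod_sym; apply: ser_eqmod => // m.
by apply: ord_geW (leqnSn _) _; exact: u0.
Qed.

Lemma ord_ge_ser k u : (forall n, fps_ord_ge k (u n)) -> fps_ord_ge k (ser u).
Proof. by move=> uk i lti; rewrite /= fps_coef_sum big1// => j _; exact: uk. Qed.

(** Coefficient n of [ser u] only sees the partial sum [V n], so it is enough that [V n] agrees with
    L up to that coefficient. In the applications [V] is the closed form found by creative
    telescoping. *)
Lemma ser_telescope u (V : nat -> fps R) L :
  V 0%N = u 0%N -> (forall n, V n.+1 = V n + u n.+1) ->
  (forall n, fps_eqmod n.+1 (V n) L) -> ser u = L.
Proof.
move=> V0 VS VL; have uV n : \sum_(i < n.+1) u i = V n.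
  by elim: n => [|n IHn]; rewrite ?big_ord1// big_ord_recr /= IHn VS.
apply/fpsP => n; rewrite /= uV; apply/eqP; rewrite -subr_eq0; apply/eqP.
exact: VL.
Qed.

(** Exchange of summation along n = r + m. The order bound r + m lets both sides be compared, modulo
    q^M, with the same finite triangle r + m < M. *)
Lemma ser_diag (a : nat -> nat -> fps R) :
  (forall r m, fps_ord_ge (r + m) (a r m)) ->
  ser (fun n => \sum_(r < n.+1) a r (n - r)%N) = ser (fun r => ser (a r)).
Proof.
move=> a0.
have sa r : small (a r) by move=> m; apply: ord_geW (a0 r m); exact: leq_addl.
apply: eqmodP => M.
apply: (@eqmod_trans _ (\sum_(n < M) \sum_(r < n.+1) a r (n - r)%N)).
  apply: ser_eqmod => // n; apply: ord_ge_sum => -[r ltr] _ /=.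
  by apply: ord_geW (a0 _ _); lia.
have -> : \sum_(n < M) \sum_(r < n.+1) a r (n - r)%N =
          \sum_(r < M) \sum_(m < M - r) a r m.
  have E (n : 'I_M) : \sum_(r < n.+1) a r (n - r)%N =
                      \sum_(r < M | (r <= n)%N) a r (n - r)%N.
    by rewrite (big_ord_widen M (fun r => a r (n - r)%N)).
  rewrite (eq_bigr _ (fun n _ => E n)).
  rewrite (exchange_big_dep xpredT) //=; apply: eq_bigr => r _.
  rewrite -(big_mkord (fun j => (r <= j)%N) (fun j => a r (j - r)%N)).
  rewrite (@big_cat_nat _ _ _ r) //=; last exact: ltnW.
  rewrite big_nat_cond big_pred0 ?Monoid.mul1m; last by move=> i; lia.
  rewrite -{1}(add0n (nat_of_ord r)) big_addn big_mkord.
  by apply: eq_big => [i|i _]; [lia | congr (a r _); lia].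
apply: eqmod_sym.
apply: (@eqmod_trans _ (\sum_(r < M) ser (a r))).
  apply: ser_eqmod => // r; apply: ord_ge_ser => m.
  by apply: ord_geW (a0 r m); exact: leq_addr.
rewrite /fps_eqmod -sumrB; apply: ord_ge_sum => r _.
move=> i lti; rewrite fps_coefB /= !fps_coef_sum.
apply/eqP; rewrite subr_eq0; apply/eqP.
rewrite -(big_mkord xpredT (fun j => a r j i)) -(big_mkord xpredT (fun j => a r j i)).
(* One side sums the first M - r terms, the other the first i.+1. The surplus terms of the longer
   one have r + j >= M > i in the first case and j > i in the second, so they do not reach
   coefficient i. *)
have [leMi|ltiM] := leqP (M - r)%N i.+1.
  rewrite (@big_cat_nat _ _ _ (M - r)%N)//= [X in _ + X]big_nat [X in _ + X]big1 ?addr0//.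
  by move=> j /andP[lej ltj]; apply: a0; lia.
rewrite (@big_cat_nat _ _ _ i.+1 0 (M - r)%N)//=; last by lia.
by rewrite [X in _ + X]big_nat [X in _ + X]big1 ?addr0// => j /andP[lej ltj]; apply: a0; lia.
Qed.

(** The difference D satisfies D r = B r * D r.+1, and unrolling this n times exhibits n factors of
    positive order. *)
Lemma recurrence_unique (F G A B : nat -> fps R) :
  (forall r, fps_ord_ge 1 (B r)) ->
  (forall r, F r = A r + B r * F r.+1) -> (forall r, G r = A r + B r * G r.+1) ->
  forall r, F r = G r.
Proof.
move=> B0 FE GE r; apply: eqmodP => n; elim: n r => // n IHn r.
rewrite /fps_eqmod FE GE.
have -> : A r + B r * F r.+1 - (A r + B r * G r.+1) = B r * (F r.+1 - G r.+1).
  by ring.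
by rewrite -(add1n n); apply: ord_geM => //; exact: IHn.
Qed.

(** The complementary case where the coefficient of the recurrence is 1: unrolling gains no order,
    but it moves r arbitrarily far, where F is close to L. *)
Lemma constant_limit (F : nat -> fps R) L :
  (forall r, F r = F r.+1) -> (forall r, fps_eqmod r (F r) L) -> forall r, F r = L.
Proof.
move=> FS FL r; apply: eqmodP => n.
have FE m : F (m + r)%N = F r by elim: m => // m <-; rewrite addSn -FS.
by rewrite -(FE n); apply: eqmodW (FL _); exact: leq_addr.
Qed.

End Series.

(** * Sums over sets of indices rewritten as series over the naturals *)

Section Families.
Variable R : comUnitRingType.
Implicit Types (u : nat -> fps R).

Lemma fps_sum_ser (I : choiceType) (D : set I) (F : I -> fps R) (f : nat -> I) u :
  injective f -> (forall n, D (f n)) -> (forall i, D i -> exists n, i = f n) ->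
  (forall n, F (f n) = u n) -> small u -> fps_sum D F = ser u.
Proof.
move=> finj fD Df Fu u0; apply/fpsP => n.
rewrite /= (fsbigE [seq f j | j <- iota 0 n.+1]).
- rewrite big_map fps_coef_sum -/(index_iota 0 n.+1) big_mkord.
  by apply: eq_big => [i|i _]; [exact/mem_set/fD | rewrite Fu].
- by rewrite map_inj_uniq ?iota_uniq.
- by move=> i /mapP[j _ ->]; exact: fD.
move=> i /Df[j ->] jn; rewrite Fu u0//; move: jn.
by rewrite mem_map// mem_iota /= add0n -leqNgt.
Qed.

Lemma fps_sum_nat_ge1 (F : nat -> fps R) u :
  (forall n, F n.+1 = u n) -> small u ->
  fps_sum [set n | (1 <= n)%N]%classic F = ser u.
Proof.
apply: fps_sum_ser => [n m []//|//|[//|n] _]; by exists n.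
Qed.

Lemma fps_sum_int_ge0 (F : int -> fps R) u :
  (forall n : nat, F n%:Z = u n) -> small u ->
  fps_sum [set n | 0 <= n]%classic F = ser u.
Proof.
apply: fps_sum_ser => [n m []//|//|[n|//] _]; by exists n.
Qed.

Lemma fps_sum_int_ge1 (F : int -> fps R) u :
  (forall n : nat, F n.+1%:Z = u n) -> small u ->
  fps_sum [set n | 1 <= n]%classic F = ser u.
Proof.
apply: fps_sum_ser => [n m []//|//|[[//|n]|//] _]; by exists n.
Qed.

(** A bilateral sum is folded along two enumerations that partition the integers. They are left free
    because the folding of C5 (k <= 0 and k >= 1) differs from that of A5 and A7 (k >= 0 and k <=
    -1). *)
Lemma fps_sum_int (F : int -> fps R) (f g : nat -> int) u v :
  injective f -> injective g -> (forall n m, f n != g m) ->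
  (forall i, exists n, i = f n \/ i = g n) ->
  (forall n, F (f n) = u n) -> (forall n, F (g n) = v n) -> small u -> small v ->
  fps_sum [set: int]%classic F = ser (fun n => u n + v n).
Proof.
move=> finj ginj fg fgsur Fu Fv u0 v0; apply/fpsP => n.
rewrite serD fps_coefD /=.
rewrite (fsbigE ([seq f j | j <- iota 0 n.+1] ++ [seq g j | j <- iota 0 n.+1])).
- rewrite (eq_bigl xpredT) => [|i]; last exact/mem_set.
  rewrite big_cat !big_map !fps_coef_sum.
  rewrite -/(index_iota 0 n.+1) !big_mkord.
  by congr (_ + _); apply: eq_bigr => i _; rewrite ?Fu ?Fv.
- rewrite cat_uniq !map_inj_uniq// iota_uniq andbT.
  by apply/hasPn => i /mapP[j _ ->]; apply/mapP => -[k _ /eqP]; rewrite eq_sym (negbTE (fg _ _)).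
- by [].
move=> i _; rewrite mem_cat negb_or => /andP[].
have [j [->|->]] := fgsur i.
  by rewrite mem_map// mem_iota /= add0n -leqNgt Fu => ltnj _; apply: u0.
by move=> _; rewrite mem_map// mem_iota /= add0n -leqNgt Fv => ltnj; apply: v0.
Qed.

End Families.

(** * Truncating and splitting q-Pochhammer symbols *)

Section Pochhammer.
Variable R : comUnitRingType.
Implicit Types a b q : fps R.

Lemma qpochS a q n : qpoch a q n.+1 = qpoch a q n * (1 - a * q ^+ n).
Proof. by rewrite /qpoch big_ord_recr. Qed.

Lemma qpoch0 a q : qpoch a q 0 = 1.
Proof. by rewrite /qpoch big_ord0. Qed.

Lemma qpochD a q m n : qpoch a q (m + n) = qpoch a q m * qpoch (a * q ^+ m) q n.
Proof.
elim: n => [|n IHn]; first by rewrite addn0 qpoch0 mulr1.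
by rewrite addnS !qpochS IHn exprD !mulrA.
Qed.

Lemma ord_ge_expr q n : q 0%N = 0 -> fps_ord_ge n (q ^+ n).
Proof. by move=> q0 i; exact: coef_fpsX_lt. Qed.

Lemma qpoch_eqmod k a q n m : q 0%N = 0 -> fps_ord_ge k a -> (n <= m)%N ->
  fps_eqmod (k + n) (qpoch a q m) (qpoch a q n).
Proof.
move=> q0 ak /subnKC <-; elim: (m - n)%N => [|d IHd].
  by rewrite addn0; exact: eqmod_refl.
apply: eqmod_trans IHd; rewrite addnS qpochS /fps_eqmod.
rewrite (_ : _ - _ = (a * q ^+ (n + d)) * - qpoch a q (n + d)); last by ring.
apply/ord_geMl/ord_geM => //.
apply: (@ord_geW _ n (n + d)); [exact: leq_addr | exact: ord_ge_expr].
Qed.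

Lemma qpoch_inf_eqmod k a q n : q 0%N = 0 -> fps_ord_ge k a ->
  fps_eqmod (k + n) (qpoch_inf a q) (qpoch a q n).
Proof.
move=> q0 ak i lti; rewrite fps_coefB qpoch_infE//.
have [leni|ltin] := leqP n i.+1.
  by have := qpoch_eqmod q0 ak leni lti.
(* Coefficient i of the infinite product is that of the product of i.+1 factors, here shorter than
   the product of n factors. The trivial order 0 of [a] already gives agreement modulo q^(i+1). *)
have a0 : fps_ord_ge 0 a by [].
have := @qpoch_eqmod 0%N a q i.+1 n q0 a0 (ltnW ltin) i.
by rewrite add0n ltnS leqnn !fps_coefB => /(_ isT) /eqP; rewrite subr_eq0 => /eqP ->; rewrite subrr.
Qed.

Lemma qpoch_infD a q n : q 0%N = 0 ->
  qpoch_inf a q = qpoch a q n * qpoch_inf (a * q ^+ n) q.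
Proof.
move=> q0; apply: eqmodP => m; have a0 b : fps_ord_ge 0 b by [].
apply: (@eqmod_trans _ _ (qpoch a q (n + m))).
  apply: (@eqmodW _ m (0 + (n + m))); first by lia.
  exact: qpoch_inf_eqmod.
rewrite qpochD; apply: eqmodM; first exact: eqmod_refl.
by apply: eqmod_sym; exact: qpoch_inf_eqmod (a0 _).
Qed.

Lemma qpoch_coef0 a q n : a 0%N = 0 -> qpoch a q n 0%N = 1.
Proof.
move=> a0; elim: n => [|n IHn]; first by rewrite qpoch0.
by rewrite qpochS fps_coef0M IHn mul1r fps_coefB fps_coef0M a0 mul0r subr0.
Qed.

Lemma qpoch_unit a q n : a 0%N = 0 -> qpoch a q n \is a GRing.unit.
Proof. by move=> a0; rewrite fps_unitE qpoch_coef0 ?unitr1. Qed.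

Lemma qpoch_inf_unit a q : q 0%N = 0 -> a 0%N = 0 -> qpoch_inf a q \is a GRing.unit.
Proof. by move=> q0 a0; rewrite fps_unitE qpoch_infE// qpoch_coef0 ?unitr1. Qed.

End Pochhammer.

(** * The finite Jacobi triple product *)

Section FiniteExpansion.
Variable R : comUnitRingType.
Local Notation q := (fpsX R).
Local Notation p := (qpoch q q).

Lemma euler_unit n : p n \is a GRing.unit.
Proof. exact: qpoch_unit. Qed.

Lemma eulerS n : p n.+1 = p n * (1 - q ^+ n.+1).
Proof. by rewrite qpochS -exprS. Qed.

(** Oriented so that rewriting raises the index. Bringing all inverses to one common index turns an
    identity of fractions into one that [ring] proves without division. *)
Lemma eulerV n : (p n)^-1 = (1 - q ^+ n.+1) * (p n.+1)^-1.
Proof.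
have U := euler_unit n.+1; apply: (mulIr (euler_unit n)); apply: (mulIr U).
by rewrite mulVr ?euler_unit// mul1r mulrAC mulrVK// eulerS mulrC.
Qed.

(* [1 / (q;q)_(n-2)], with the convention [1 / (q;q)_m = 0] for negative [m] *)
Definition euler_inv_shift n : fps R := if n is m.+2 then (p m)^-1 else 0.
Local Notation ip := euler_inv_shift.

(** The convention for negative indices makes this hold at n = 0 too, where both sides are 0. *)
Lemma euler_inv_shiftS n : ip n.+1 = (1 - q ^+ n) * ip n.+2.
Proof.
case: n => [|n]; first by rewrite expr0 subrr mul0r.
by rewrite /= eulerV.
Qed.

(** Two steps of the previous lemma give the factors 1 - q^(n-1) and 1 - q^n; multiplying by q
    avoids the exponent n - 1. *)
Lemma euler_inv_shiftSS n : q * ip n = (q - q ^+ n) * (1 - q ^+ n) * ip n.+2.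
Proof.
rewrite -mulrA -euler_inv_shiftS; case: n => [|n]; first by rewrite /= !mulr0.
by rewrite euler_inv_shiftS exprS; ring.
Qed.

Definition triple_coef n r : fps R :=
  (-1) ^+ r * q ^+ 'C(r, 2) * (1 - q ^+ (2 * r + 1))
  * p (2 * n) * ip (n.+2 - r) * (p (n + r + 1))^-1.
Local Notation c := triple_coef.

Lemma triple_coef_eq0 n r : (n < r)%N -> c n r = 0.
Proof.
move=> ltnr; rewrite /c; have : (n.+2 - r <= 1)%N by lia.
by case: (n.+2 - r)%N => [|[|//]] _; rewrite /= !(mulr0, mul0r).
Qed.

(** Passing from n to n.+1 multiplies by (1 - z q^n)(1 - q^n/z) = 1 + q^(2n) - q^n (z + 1/z), and z
    + 1/z sends w_r to w_(r+1) + w_(r-1). Since w_(-1) = w_0, at r = 0 the coefficient [c n 0] takes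
    the place of the missing [c n (-1)]. *)
Lemma triple_coefS0 n :
  c n.+1 0 = (1 + q ^+ (2 * n)) * c n 0 - q ^+ n * (c n 0 + c n 1).
Proof.
rewrite /c !subn0 subSS subn0 muln0 !add0n !addn0 !addn1 bin0n expr0 expr1.
rewrite bin_small// expr0 [ip n.+1]euler_inv_shiftS [ip n.+3]/= [ip n.+2]/=.
rewrite (_ : (2 * n.+1 = (2 * n).+2)%N); last by lia.
rewrite (eulerS (2 * n).+1) (eulerS (2 * n)) (eulerV n) (eulerV n.+1) mul2n -addnn !exprS !exprD.
move: (p n.+2)^-1 (p (n + n)) (q ^+ n) => a b s.
by ring.
Qed.

Lemma triple_coefSS n s : c n.+1 s.+1 =
  (1 + q ^+ (2 * n)) * c n s.+1 - q ^+ n * (c n s + c n s.+2).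
Proof.
have [ltns|lesn] := ltnP n s.
  by rewrite !triple_coef_eq0 ?addr0 ?mulr0 ?subr0//; lia.
(* Writing n = s + j removes every truncated subtraction. *)
rewrite -(subnKC lesn); move: (n - s)%N => j {lesn n}; rewrite /c.
rewrite (_ : ((s + j).+3 - s.+1 = j.+2)%N); last by lia.
rewrite (_ : ((s + j).+2 - s.+1 = j.+1)%N); last by lia.
rewrite (_ : ((s + j).+2 - s = j.+2)%N); last by lia.
rewrite (_ : ((s + j).+2 - s.+2 = j)%N); last by lia.
rewrite (_ : 'C(s.+2, 2) = 'C(s, 2) + s + s + 1)%N; last by rewrite !binS !bin1 !bin0; lia.
rewrite (_ : 'C(s.+1, 2) = 'C(s, 2) + s)%N; last by rewrite !binS !bin1; lia.
rewrite (_ : (2 * (s + j).+1 = (2 * (s + j)).+2)%N); last by lia.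
rewrite (_ : ((s + j).+1 + s.+1 + 1 = (s + s + j).+3)%N); last by lia.
rewrite (_ : (s + j + s.+1 + 1 = (s + s + j).+2)%N); last by lia.
rewrite (_ : (s + j + s + 1 = (s + s + j).+1)%N); last by lia.
rewrite (_ : (s + j + s.+2 + 1 = (s + s + j).+3)%N); last by lia.
rewrite (eulerS (2 * (s + j)).+1) (eulerS (2 * (s + j))) [ip j.+1]euler_inv_shiftS.
rewrite [(p (s + s + j).+1)^-1]eulerV [(p (s + s + j).+2)^-1]eulerV.
have := euler_inv_shiftSS j; set X := ip j => EX.
(* One q is taken out of the power so that the product q * X appears, the only form in which
   [euler_inv_shiftSS] applies. *)
rewrite (_ : (-1) ^+ s.+2 * q ^+ ('C(s, 2) + s + s + 1)
   * (1 - q ^+ (2 * s.+2 + 1)) * p (2 * (s + j)) * X * (p (s + s + j).+3)^-1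
  = (-1) ^+ s.+2 * q ^+ ('C(s, 2) + s + s)
   * (1 - q ^+ (2 * s.+2 + 1)) * p (2 * (s + j)) * (p (s + s + j).+3)^-1
   * (q * X)); last by rewrite [q ^+ (_ + 1)]exprD; ring.
rewrite {X}EX !mul2n -!addnn !(exprS, exprD, addSn, addnS).
move: (p (s + s + j).+3)^-1 (p (s + j + (s + j))) (ip j.+2) => a b d.
by move: (q ^+ s) (q ^+ j) (q ^+ 'C(s, 2)) ((-1) ^+ s) => x y u v; ring.
Qed.

(** Only the action of e = z + 1/z on the w_r enters, with its reflected boundary at r = 0.
    Abstracting it lets one induction serve both for the w_r and for the constant sequence 1 with e
    = 2, the case z = 1. The sum may run past r = n, which makes index shifts harmless. *)
Lemma sum_triple_coef (e : fps R) (u : nat -> fps R) n M :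
  e * u 0%N = u 1%N + u 0%N -> (forall r, e * u r.+1 = u r.+2 + u r) -> (n < M)%N ->
  \sum_(r < M) c n r * u r = (\prod_(j < n) (1 - e * q ^+ j + q ^+ (2 * j))) * u 0%N.
Proof.
move=> e0 eS; elim: n M => [|n IHn] [//|M] ltnM.
  rewrite big_ord0 mul1r big_ord_recl big1 ?addr0 => [|i _]; last first.
    by rewrite triple_coef_eq0 ?mul0r.
  suff -> : c 0 0 = 1 by rewrite mul1r.
  have := divrr (euler_unit 1); rewrite eulerS qpoch0 mul1r => E.
  by rewrite /c /= eulerS qpoch0 invr1 !mul1r !mulr1 E.
rewrite [in RHS]big_ord_recr /= [RHS]mulrAC -(IHn M.+1); last by lia.
set S := \sum_(r < M.+1) c n r * u r.
(* [G] and [H] shift the summation index; the terms gained at the top contain [c n M] and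
   [c n M.+1], which vanish as n < M. *)
have G : \sum_(s < M) c n s * u s.+1 =
         c n 0 * u 1%N + \sum_(s < M) c n s.+1 * u s.+2.
  have : \sum_(s < M.+1) c n s * u s.+1 = \sum_(s < M) c n s * u s.+1 + c n M * u M.+1.
    by rewrite big_ord_recr.
  rewrite big_ord_recl /= (triple_coef_eq0 (n := n) (r := M)) ?mul0r ?addr0; last by lia.
  by move=> <-.
have H : \sum_(s < M) c n s.+1 * u s = c n 1 * u 0%N + \sum_(s < M) c n s.+2 * u s.+1.
  have : \sum_(s < M.+1) c n s.+1 * u s = \sum_(s < M) c n s.+1 * u s + c n M.+1 * u M.
    by rewrite big_ord_recr.
  rewrite big_ord_recl /= (triple_coef_eq0 (n := n) (r := M.+1)) ?mul0r ?addr0; last by lia.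
  by move=> <-.
have eS' : e * S = c n 0 * (u 1%N + u 0%N) +
    (\sum_(s < M) c n s.+1 * u s.+2 + \sum_(s < M) c n s.+1 * u s).
  rewrite /S big_ord_recl mulrDr mulrCA e0 mulr_sumr -big_split; congr (_ + _).
  by apply: eq_bigr => i _; rewrite mulrCA eS mulrDr.
rewrite big_ord_recl triple_coefS0.
have -> : \sum_(i < M) c n.+1 (lift ord0 i) * u (lift ord0 i) =
   (1 + q ^+ (2 * n)) * \sum_(i < M) c n i.+1 * u i.+1
   - q ^+ n * (\sum_(i < M) c n i * u i.+1 + \sum_(i < M) c n i.+2 * u i.+1).
  rewrite -big_split !mulr_sumr -sumrB; apply: eq_bigr => i _.
  by rewrite triple_coefSS /=; ring.
have ES : S = c n 0 * u 0%N + \sum_(i < M) c n i.+1 * u i.+1 by rewrite /S big_ord_recl.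
transitivity (S + q ^+ (2 * n) * S - q ^+ n * (e * S)); last by ring.
by rewrite eS' H G ES; ring.
Qed.

End FiniteExpansion.

(** * Expansion of the left-hand sides over [zfactor] *)

Section Master.
Variables (R : comUnitRingType) (z : fps R).
Hypothesis zU : z \is a GRing.unit.
Local Notation q := (fpsX R).
Local Notation p := (qpoch q q).
Local Notation c := (@triple_coef R).

Definition zfactor r : fps R := (1 - z ^+ r) * (1 - z ^+ r.+1) * z^-1 ^+ r.

Lemma zfactorE r : zfactor r = z ^+ r.+1 + z^-1 ^+ r - (1 + z).
Proof.
have E : z ^+ r * z^-1 ^+ r = 1 by rewrite -exprMn divrr// expr1n.
transitivity (z^-1 ^+ r - (1 + z) * (z ^+ r * z^-1 ^+ r) + z ^+ r.+1 * (z ^+ r * z^-1 ^+ r)).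
  by rewrite /zfactor exprS; ring.
by rewrite E; ring.
Qed.

Lemma zfactor0 : zfactor 0 = 0.
Proof. by rewrite /zfactor expr0 subrr !mul0r. Qed.

Lemma qpoch_pairE n : (1 + z) * (qpoch z q n * qpoch z^-1 q n) =
  \sum_(r < n.+1) c n r * (z ^+ r.+1 + z^-1 ^+ r).
Proof.
have E : z * z^-1 = 1 by rewrite divrr.
rewrite (@sum_triple_coef _ (z + z^-1) (fun r => z ^+ r.+1 + z^-1 ^+ r))//.
- rewrite /qpoch -big_split expr0 expr1 mulrC [1 + z]addrC; congr (_ * _).
  apply: eq_bigr => j _ /=.
  transitivity (1 - (z + z^-1) * q ^+ j + z * z^-1 * (q ^+ j * q ^+ j)); first by ring.
  by rewrite E mul2n -addnn exprD mul1r.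
- rewrite !expr1 expr0 expr2; transitivity (z * z + z * z^-1 + z + z^-1); first by ring.
  by rewrite E; ring.
move=> r; rewrite !exprS.
transitivity (z * (z * (z * z ^+ r)) + z * z^-1 * (z * z ^+ r)
              + z * z^-1 * z^-1 ^+ r + z^-1 * (z^-1 * z^-1 ^+ r)); first by ring.
by rewrite E; ring.
Qed.

Lemma sum_triple_coef1 n : \sum_(r < n.+2) c n.+1 r = 0.
Proof.
rewrite (eq_bigr (fun r : 'I_n.+2 => c n.+1 r * 1)) => [|r _]; last by rewrite mulr1.
rewrite (@sum_triple_coef _ 2 (fun=> 1))//; try by move=> *; ring.
(* The factor j = 0 of the product is 1 - 2 + 1 = 0. *)
by rewrite big_ord_recl muln0 !expr0 (_ : 1 - 2 * 1 + 1 = 0) ?mul0r//; ring.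
Qed.

Lemma qpoch_pair_zfactor n : (0 < n)%N ->
  (1 + z) * (qpoch z q n * qpoch z^-1 q n) = \sum_(r < n.+1) c n r * zfactor r.
Proof.
case: n => // n _; rewrite qpoch_pairE; apply/eqP; rewrite -subr_eq0 -sumrB.
rewrite (eq_bigr (fun r : 'I_n.+2 => c n.+1 r * (1 + z))) => [|r _].
  by rewrite -mulr_suml sum_triple_coef1 mul0r.
by rewrite zfactorE; ring.
Qed.

Lemma qpoch2_infD n : qpoch2_inf z z^-1 q =
  qpoch z q n * qpoch z^-1 q n * qpoch2_inf (z * q ^+ n) (z^-1 * q ^+ n) q.
Proof. by rewrite /qpoch2_inf (qpoch_infD z n)// (qpoch_infD z^-1 n)// mulrACA. Qed.

Lemma qpoch2_inf_unit n : (0 < n)%N ->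
  qpoch2_inf (z * q ^+ n) (z^-1 * q ^+ n) q \is a GRing.unit.
Proof.
by move=> n0; rewrite unitrM !qpoch_inf_unit// fps_coef0M (@ord_ge_X _ n 0)// mulr0.
Qed.

(** With n = m + r, this is the summand of index n weighted by the part of [c n r] that depends on
    n. Its sum over m is the member indexed by r of the conjugate Bailey pair. *)
Definition inner_term (d : nat -> fps R) r m :=
  d (m + r)%N * p (2 * (m + r)) / (p m * p (m + (2 * r + 1))).

Lemma bailey_expansion (d : nat -> fps R) : small d ->
  (1 + z) * qpoch2_inf z z^-1 q *
  (\fsum_(n \in [set n | (1 <= n)%N])
     (d n / qpoch2_inf (z * q ^+ n) (z^-1 * q ^+ n) q)) =
  ser (fun r => (-1) ^+ r * q ^+ 'C(r, 2) * (1 - q ^+ (2 * r + 1)) * zfactor r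
                * ser (inner_term d r)).
Proof.
move=> d0; set t := fun n => d n / qpoch2_inf (z * q ^+ n) (z^-1 * q ^+ n) q.
have t0 : small t by move=> n; exact/ord_geMl/d0.
(* A zero term is put at n = 0, where [t] would involve the possibly non-invertible (z, 1/z; q)_oo.
   It matches the expansion, whose only term at n = 0 carries [zfactor z 0] = 0. *)
have t0' : small (fun n => if n is m.+1 then t n else 0).
  by case=> // n; exact: t0.
rewrite (@fps_sum_nat_ge1 _ _ (fun n => t n.+1))//; last first.
  by move=> n; apply: (@ord_geW _ _ n.+1) => //; exact: t0.
transitivity ((1 + z) * qpoch2_inf z z^-1 q * ser (fun n => if n is m.+1 then t n else 0)).
  by rewrite (ser_recl t0') add0r.
rewrite serMl//.
pose a r m : fps R := d (m + r)%N * (c (m + r) r * zfactor r).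
transitivity (ser (fun n => \sum_(r < n.+1) a r (n - r)%N)).
  apply: eq_ser => n.
  transitivity (d n * \sum_(r < n.+1) c n r * zfactor r).
    case: n => [|n]; first by rewrite mulr0 big_ord1 zfactor0 !mulr0.
    rewrite -qpoch_pair_zfactor// (qpoch2_infD n.+1) /t.
    have := qpoch2_inf_unit (ltn0Sn n).
    move: (qpoch2_inf _ _ _) => f fU.
    transitivity (d n.+1 * ((1 + z) * (qpoch z q n.+1 * qpoch z^-1 q n.+1)) * (f / f)).
      by ring.
    by rewrite divrr// mulr1.
  rewrite mulr_sumr; apply: eq_bigr => r _; rewrite /a subnK//.
  by rewrite -ltnS.
rewrite ser_diag => [|r m]; last by rewrite addnC; exact/ord_geMl/d0.
apply: eq_ser => r; rewrite serMl; last first.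
  by move=> m; do 2 apply: ord_geMl; apply: ord_geW (d0 _); exact: leq_addr.
apply: eq_ser => m; rewrite /a /inner_term /c /triple_coef.
rewrite (_ : (m + r).+2 - r = m.+2)%N; last by lia.
rewrite (_ : m + r + r + 1 = m + (2 * r + 1))%N; last by lia.
by rewrite invrM ?euler_unit//=; ring.
Qed.

End Master.

(** Splits the powers of q into atoms such as [q ^+ m], [q ^+ (N * m)] and [q ^+ 'C(m, 2)], which
    are then generalized so that [ring] faces a polynomial identity. *)
Ltac expand_q := rewrite ?(binS _ 1) ?bin1 ?bin0 ?(mulnS, mulSn, mulnDr, mulnDl, muln1, mul1n,
  muln0, mul0n, mul2n, addn0, add0n, =^~ addnn, addnS, addSn, exprD, exprS, expr0).

(** * Infinite products, and the sums behind A1 and A3 *)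

Section Products.
Variable R : comUnitRingType.
Local Notation q := (fpsX R).
Local Notation p := (qpoch q q).
Local Notation o := (qpoch q (q ^+ 2)).
Local Notation e := (qpoch (q ^+ 2) (q ^+ 2)).
Local Notation P := (qpoch_inf q q).
Local Notation O := (qpoch_inf q (q ^+ 2)).
Local Notation E := (qpoch_inf (q ^+ 2) (q ^+ 2)).

Lemma fpsX2_coef0 : (q ^+ 2) 0%N = 0.
Proof. exact: (@ord_ge_X _ 2 0). Qed.
Hint Resolve fpsX2_coef0 : core.

Lemma ord_ge_X1 : fps_ord_ge 1 q.
Proof. by rewrite -[q]expr1; exact: ord_ge_X. Qed.

Lemma qpoch_oddS n : o n.+1 = o n * (1 - q ^+ (2 * n + 1)).
Proof. by rewrite qpochS -exprM -exprS addn1. Qed.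

Lemma qpoch_evenS n : e n.+1 = e n * (1 - q ^+ (2 * n + 2)).
Proof. by rewrite qpochS -exprM -exprD addnC. Qed.

Lemma euler_double n : p (2 * n) = o n * e n.
Proof.
elim: n => [|n IHn]; first by rewrite muln0 !qpoch0 mulr1.
rewrite qpoch_oddS qpoch_evenS mulrACA -IHn (_ : (2 * n.+1 = (2 * n).+2)%N); last by lia.
by rewrite !eulerS -mulrA; congr (_ * (_ * _)); congr (1 - q ^+ _); lia.
Qed.

Lemma euler_eqmod k n : (k <= n.+1)%N -> fps_eqmod k (p n) P.
Proof.
move=> lekn; apply: (eqmodW lekn); apply: eqmod_sym; rewrite -add1n.
by apply: qpoch_inf_eqmod => //; exact: ord_ge_X1.
Qed.

Lemma odd_eqmod k n : (k <= n.+1)%N -> fps_eqmod k (o n) O.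
Proof.
move=> lekn; apply: (eqmodW lekn); apply: eqmod_sym; rewrite -add1n.
by apply: qpoch_inf_eqmod => //; exact: ord_ge_X1.
Qed.

Lemma even_eqmod k n : (k <= n.+1)%N -> fps_eqmod k (e n) E.
Proof.
move=> lekn; apply: (@eqmodW _ k (2 + n)); first by lia.
by apply: eqmod_sym; apply: qpoch_inf_eqmod => //; exact: ord_ge_X.
Qed.

Lemma euler_inf_unit : P \is a GRing.unit.
Proof. exact: qpoch_inf_unit. Qed.
Lemma eulerV_eqmod k n : (k <= n.+1)%N -> fps_eqmod k (p n)^-1 P^-1.
Proof.
move=> lekn; apply: eqmodV; [exact: euler_unit | exact: euler_inf_unit |].
exact: euler_eqmod.
Qed.

Lemma euler_inf_double : P = O * E.
Proof.
apply: eqmodP => n; apply: (@eqmod_trans _ _ (p (2 * n))).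
  by apply/eqmod_sym/euler_eqmod; lia.
by rewrite euler_double; apply: eqmodM; [apply: odd_eqmod | apply: even_eqmod]; lia.
Qed.

Lemma eqmod_ord_ge k (f : fps R) : fps_ord_ge k f -> fps_eqmod k f 0.
Proof. by rewrite /fps_eqmod subr0. Qed.

Lemma eqmod_1D k (f : fps R) : fps_ord_ge k f -> fps_eqmod k (1 + f) 1.
Proof. by rewrite /fps_eqmod addrAC subrr add0r. Qed.

(** Up to the factor 1/(q;q)_N, the summand of the basic hypergeometric series 2phi1(0, 0; q^(N+1);
    q, q^j). *)
Definition heine_term j N m : fps R := q ^+ (j * m) * (p m)^-1 * (p (m + N))^-1.

Lemma heine_term_small j N : (0 < j)%N -> small (heine_term j N).
Proof.
move=> j0 m; do 2 apply: ord_geMl; apply: ord_ge_Xle.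
exact: leq_pmull.
Qed.

Definition partial_theta N n : fps R := (-1) ^+ n * q ^+ (N * n + 'C(n.+1, 2)).

Lemma bin2S n : 'C(n.+1, 2) = ('C(n, 2) + n)%N.
Proof. by rewrite binS bin1. Qed.

Lemma leq_bin2S n : (n <= 'C(n.+1, 2))%N.
Proof. by rewrite bin2S leq_addl. Qed.

Lemma partial_theta_small N : small (partial_theta N).
Proof.
by move=> n; apply/ord_geMr/ord_ge_Xle; apply: leq_trans (leq_bin2S n) _; exact: leq_addl.
Qed.

(** Both sides satisfy F N = 1 - q^(N+1) F (N+1). On the left the partial sums are 1/((q;q)_M
    (q;q)_(M+N+1)), which tend to 1/P^2; on the right one removes the first term. *)
Lemma ser_heine_term1 N : P * P * ser (heine_term 1 N) = ser (partial_theta N).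
Proof.
apply: (@recurrence_unique _ (fun N => P * P * ser (heine_term 1 N))
  (fun N => ser (partial_theta N)) (fun=> 1) (fun N => - q ^+ N.+1)) => {N}.
- by move=> N; apply/ord_geN/ord_ge_Xle.
- move=> N; suff H : ser (heine_term 1 N) + q ^+ N.+1 * ser (heine_term 1 N.+1) = P^-1 * P^-1.
    transitivity (P * P * (ser (heine_term 1 N) + q ^+ N.+1 * ser (heine_term 1 N.+1))
      - q ^+ N.+1 * (P * P * ser (heine_term 1 N.+1))); first by ring.
    by rewrite H mulrACA divrr ?euler_inf_unit//; ring.
  rewrite serMl; last exact: heine_term_small.
  rewrite -serD; apply: (@ser_telescope _ _ (fun M => (p M)^-1 * (p (M + N.+1))^-1)).
  + rewrite /heine_term muln0 !add0n qpoch0 invr1 expr0 !mul1r [(p N)^-1]eulerV.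
    by ring.
  + move=> m; rewrite /heine_term !addnS !addSn mul1n [(p m)^-1]eulerV.
    rewrite [(p (m + N).+1)^-1]eulerV !exprS exprD.
    move: (p m.+1)^-1 (p (m + N).+2)^-1 (q ^+ m) (q ^+ N) => a b x y; ring.
  by move=> M; apply: eqmodM; apply: eulerV_eqmod; lia.
move=> N; rewrite (ser_recl (@partial_theta_small N)) {1}/partial_theta muln0 expr0 !mulr1.
rewrite mulNr serMl; last exact: partial_theta_small.
congr (_ + _); rewrite -[RHS]mulN1r serMl; last first.
  by move=> n; exact/ord_geMr/partial_theta_small.
apply: eq_ser => n; rewrite /partial_theta.
transitivity ((-1) ^+ n.+1 * q ^+ (N.+1 + (N.+1 * n + 'C(n.+1, 2))) : fps R).
  by congr (_ * q ^+ _); rewrite [in LHS]bin2S; lia.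
by rewrite exprD exprS; ring.
Qed.

Definition partial_theta3 N n : fps R :=
  (-1) ^+ n * q ^+ (N * n + 'C(n, 2)) * (1 - q ^+ (2 * n + 1)).

Lemma partial_theta3_small N : (0 < N)%N -> small (partial_theta3 N).
Proof.
move=> N0 n; apply/ord_geMl/ord_geMr/ord_ge_Xle.
by apply: leq_trans (leq_addr _ _); exact: leq_pmull.
Qed.

(** A contiguous relation ([H]) ties this sum to [heine_term 1] at N and N.+1, already evaluated;
    the theta series satisfy the matching relation ([H']), so the unknown ones agree. *)
Lemma ser_heine_term2 N : (0 < N)%N ->
  P * P * ((1 - q ^+ N) * ser (heine_term 2 N)) = ser (partial_theta3 N).
Proof.
move=> N0.
have H : (1 - q ^+ N) * ser (heine_term 2 N) + q ^+ N * ser (heine_term 1 N)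
         + q * ser (heine_term 1 N.+1) = P^-1 * P^-1.
  do 3 (rewrite serMl; last exact: heine_term_small).
  rewrite -!serD.
  apply: (@ser_telescope _ _ (fun M => (1 + (1 - q ^+ N) * q ^+ M.+1)
                                      * ((p M)^-1 * (p (M + N.+1))^-1))).
  + rewrite /heine_term !muln0 !add0n qpoch0 invr1 expr0 !mul1r [(p N)^-1]eulerV !exprS.
    by move: (p N.+1)^-1 => a; ring.
  + move=> m; rewrite /heine_term !addnS !addSn mul1n mul2n -addnn [(p m)^-1]eulerV.
    rewrite [(p (m + N).+1)^-1]eulerV !(exprS, addSn, addnS) !exprD.
    move: (p m.+1)^-1 (p (m + N).+2)^-1 (q ^+ m) (q ^+ N) => a b x y; ring.
  move=> M; rewrite -[X in fps_eqmod _ _ X]mul1r.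
  apply: eqmodM; first by apply/eqmod_1D/ord_geMr/ord_ge_X.
  by apply: eqmodM; apply: eulerV_eqmod; lia.
have H' : ser (partial_theta3 N) + q ^+ N * ser (partial_theta N)
          + q * ser (partial_theta N.+1) = 1.
  rewrite (serMl _ (@partial_theta_small N)) (serMl _ (@partial_theta_small N.+1)).
  rewrite -!serD.
  apply: (@ser_telescope _ _ (fun M => 1 - (-1) ^+ M.+1 * q ^+ (N * M.+1 + 'C(M.+1, 2)))).
  + by rewrite /partial_theta3 /partial_theta !bin_small// !muln0 muln1 !addn0; ring.
  + move=> m; rewrite /partial_theta3 /partial_theta; expand_q.
    move: (q ^+ m) (q ^+ N) (q ^+ (N * m)) (q ^+ 'C(m, 2)) ((-1) ^+ m) => a b x y t.
    by ring.
  move=> M; rewrite -[X in fps_eqmod _ _ X]addr0; apply: eqmodD; first exact: eqmod_refl.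
  apply/eqmod_ord_ge/ord_geN/ord_geMr/ord_ge_Xle.
  by apply: leq_trans (leq_addr _ _); exact: leq_pmull.
have PU : P * P^-1 = 1 by rewrite divrr// euler_inf_unit.
apply: (@addIr _ (q ^+ N * ser (partial_theta N) + q * ser (partial_theta N.+1))).
rewrite addrA [RHS]addrA H' -!ser_heine_term1.
transitivity (P * P * (P^-1 * P^-1)); last by rewrite mulrACA PU mulr1.
by rewrite -H; ring.
Qed.

End Products.

(** * The sums behind A5, A7 and C1 *)

Section Sums.
Variable R : comUnitRingType.
Local Notation q := (fpsX R).
Local Notation p := (qpoch q q).
Local Notation o := (qpoch q (q ^+ 2)).
Local Notation e := (qpoch (q ^+ 2) (q ^+ 2)).
Local Notation P := (qpoch_inf q q).
Local Notation O := (qpoch_inf q (q ^+ 2)).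
Local Notation E := (qpoch_inf (q ^+ 2) (q ^+ 2)).

Lemma eulerVK : P * P^-1 = 1.
Proof. by rewrite divrr// euler_inf_unit. Qed.

Lemma ser_eqmod_ext k (u v : nat -> fps R) :
  (forall m, fps_eqmod k (u m) (v m)) -> fps_eqmod k (ser u) (ser v).
Proof.
move=> uv; rewrite (@eq_ser _ u (fun m => v m + (u m - v m))) => [|m]; last by rewrite addrC subrK.
by rewrite serD /fps_eqmod addrAC subrr add0r; exact: ord_ge_ser.
Qed.

Lemma ser_head_eqmod k (u : nat -> fps R) L : small u -> fps_eqmod k (u 0%N) L ->
  (forall m, fps_ord_ge k (u m.+1)) -> fps_eqmod k (ser u) L.
Proof.
move=> u0 uL uk; rewrite (ser_recl u0) -[L]addr0; apply: eqmodD => //.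
exact/eqmod_ord_ge/ord_ge_ser.
Qed.

Definition cauchy_term s N m : fps R := q ^+ (m * m + s * m) * (p m)^-1 * (p (m + N))^-1.

Lemma cauchy_term_small s N : small (cauchy_term s N).
Proof. by move=> m; do 2 apply: ord_geMl; apply: ord_ge_Xle; nia. Qed.

(** Cauchy's identity on Durfee rectangles. The difference between N and N.+1 telescopes to 0, and
    for large N only the term m = 0, equal to 1/(q;q)_N, survives. *)
Lemma ser_cauchy N : P * ser (cauchy_term N N) = 1.
Proof.
apply: (@constant_limit _ (fun N => P * ser (cauchy_term N N))) => {N} N; last first.
  rewrite -eulerVK; apply: eqmodM; first exact: eqmod_refl.
  apply: ser_head_eqmod; first exact: cauchy_term_small.
    by rewrite /cauchy_term !muln0 add0n qpoch0 invr1 !mul1r; exact: eulerV_eqmod.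
  by move=> m; do 2 apply: ord_geMl; apply: ord_ge_Xle; nia.
suff H : ser (cauchy_term N N) + -1 * ser (cauchy_term N.+1 N.+1) = 0.
  by congr (_ * _); apply/eqP; rewrite -subr_eq0 -H mulN1r.
rewrite serMl; last exact: cauchy_term_small.
rewrite -serD; apply: (@ser_telescope _ _ (fun M =>
  - (q ^+ (M.+1 * M.+1 + N * M.+1) * ((p M)^-1 * (p (M + N.+1))^-1)))).
- rewrite /cauchy_term !muln0 !muln1 !add0n qpoch0 invr1 [(p N)^-1]eulerV expr0 exprD !exprS.
  by move: (p N.+1)^-1 => a; ring.
- move=> m; rewrite /cauchy_term !(mulnS, mulSn) !addnS !addSn [(p m)^-1]eulerV [(p (m + N).+1)^-1]eulerV.
  move: (p m.+1)^-1 (p (m + N).+2)^-1 => a b; expand_q.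
  by move: (q ^+ m) (q ^+ N) (q ^+ (N * m)) (q ^+ (m * m)) => x y t s; ring.
move=> M; apply/eqmod_ord_ge/ord_geN/ord_geMl/ord_ge_Xle; nia.
Qed.

(** Split q^(Nm) = q^((N+1)m) + q^(Nm) (1 - q^m). The first part is Cauchy's sum at N.+1; in the
    second, 1 - q^m cancels a factor of (q;q)_m and the shift of m gives q^(N+1) times Cauchy's sum
    at N.+2. *)
Lemma ser_cauchy_pred N : P * ser (cauchy_term N N.+1) = 1 + q ^+ N.+1.
Proof.
pose s m : fps R := q ^+ (m * m + N * m) * (1 - q ^+ m) * (p m)^-1 * (p (m + N.+1))^-1.
have s0 : small s.
  by move=> m; do 3 apply: ord_geMl; apply: ord_ge_Xle; nia.
have -> : ser (cauchy_term N N.+1) = ser (cauchy_term N.+1 N.+1) + q ^+ N.+1 * ser (cauchy_term N.+2 N.+2).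
  rewrite serMl; last exact: cauchy_term_small.
  rewrite -(_ : ser s = ser (fun n => q ^+ N.+1 * cauchy_term N.+2 N.+2 n)).
    rewrite -serD; apply: eq_ser => m; rewrite /s /cauchy_term; expand_q.
    by ring.
  rewrite (ser_recl s0) {1}/s expr0 subrr mulr0 !mul0r add0r; apply: eq_ser => m.
  rewrite /s /cauchy_term !(mulnS, mulSn) !addnS !addSn [(p m)^-1]eulerV.
  move: (p m.+1)^-1 (p (m + N).+2)^-1 => a b; expand_q.
  by move: (q ^+ m) (q ^+ N) (q ^+ (N * m)) (q ^+ (m * m)) => x y t v; ring.
by rewrite mulrDr mulrCA !ser_cauchy mulr1.
Qed.

(** The quotient of [e (m + r)] by [p (m + r)] is (-q;q)_(m+r). *)
Definition rogers_term r m : fps R :=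
  q ^+ m * e (m + r) * (p (m + r))^-1 * (p m)^-1 * (p (m + (2 * r + 1)))^-1.

Lemma rogers_term_small r : small (rogers_term r).
Proof. by move=> m; do 4 apply: ord_geMl; exact: ord_ge_X. Qed.

(* [\sum_n q^(n(3n-1)/2) y^(3n) (1 - y q^n)] at [y = q^(r+1)] *)
Definition pentagonal_theta r n : fps R :=
  q ^+ (3 * 'C(n, 2) + n + 3 * r.+1 * n) * (1 - q ^+ (n + r.+1)).

Lemma pentagonal_theta_small r : small (pentagonal_theta r).
Proof. by move=> n; apply/ord_geMl/ord_ge_Xle; nia. Qed.

(* Stated for arbitrary [a], [b], [c], [d] because unifying distinct infinite products
   unfolds them and diverges. *)
Lemma limit_even (a b c d : fps R) : c = a * b -> c * d = 1 ->
  a * c * c * (b * d * d * d) = 1.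
Proof.
move=> cE cd; transitivity ((a * b) * d * (c * d) * (c * d)); first by ring.
by rewrite -cE cd !mulr1.
Qed.

Lemma step_recurrence (k l s s' y a : fps R) :
  k * l = 1 -> s + - y * s' = l * a -> k * s = a + y * (k * s').
Proof.
move=> kl H; transitivity (k * (s + - y * s') + y * (k * s')); first by ring.
by rewrite H mulrA kl mul1r.
Qed.

Lemma ser_rogers_term r : O * P * P * ser (rogers_term r) = ser (pentagonal_theta r).
Proof.
apply: (@recurrence_unique _ (fun r => O * P * P * ser (rogers_term r))
  (fun r => ser (pentagonal_theta r)) (fun r => 1 - q ^+ r.+1)
  (fun r => q ^+ (3 * r + 4))) => {r} r.
- by apply: ord_ge_Xle; lia.
(* The partial sums below tend to E (1 - q^(r+1)) / P^3, and O P^2 E / P^3 = 1 because P = O E. *)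
- apply: (step_recurrence (limit_even (euler_inf_double R) eulerVK)).
  rewrite serMl; last exact: rogers_term_small.
  rewrite -serD; apply: (@ser_telescope _ _ (fun M =>
    e (M + r) * (p (M + r))^-1 * (p M)^-1 * (p (M + (2 * r + 3)))^-1
    * ((1 - q ^+ r.+1 - q ^+ (M + (2 * r + 3))) * (1 + q ^+ (M + r.+1))))).
  + rewrite /rogers_term !add0n (_ : 2 * r.+1 + 1 = 2 * r + 3)%N; last by lia.
    rewrite !addnS !addn0 qpoch_evenS [(p r)^-1]eulerV [(p (2 * r).+1)^-1]eulerV.
    rewrite [(p (2 * r).+2)^-1]eulerV qpoch0 invr1.
    move: (p r.+1)^-1 (p (2 * r).+3)^-1 (e r) => a b c; expand_q.
    by move: (q ^+ r) => x; ring.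
  + move=> m; rewrite /rogers_term (_ : 2 * r.+1 + 1 = (2 * r).+3)%N; last by lia.
    rewrite !addnS !addSn !addn0.
    rewrite (qpoch_evenS _ (m + r).+1) (qpoch_evenS _ (m + r)).
    rewrite [(p (m + r))^-1]eulerV [(p (m + r).+1)^-1]eulerV [(p m)^-1]eulerV.
    rewrite [(p (m + 2 * r).+2)^-1]eulerV [(p (m + 2 * r).+3)^-1]eulerV.
    move: (p (m + r).+2)^-1 (p m.+1)^-1 (p (m + 2 * r).+4)^-1 (e (m + r)) => a b c d.
    expand_q.
    by move: (q ^+ m) (q ^+ r) => x y; ring.
  move=> M; apply: eqmodM.
    do 3 (apply: eqmodM; last by apply: eulerV_eqmod; lia).
    by apply: even_eqmod; lia.
  rewrite -[X in fps_eqmod _ _ X]mulr1; apply: eqmodM.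
    rewrite -[X in fps_eqmod _ _ X]addr0; apply: eqmodD; first exact: eqmod_refl.
    by apply/eqmod_ord_ge/ord_geN/ord_ge_Xle; lia.
  by apply/eqmod_1D/ord_ge_Xle; lia.
(* Shifting n by one turns the theta series at r into q^(3r+4) times the one at r.+1. *)
rewrite (ser_recl (@pentagonal_theta_small r)) {1}/pentagonal_theta.
rewrite bin0n !muln0 expr0 mul1r add0n; congr (_ + _).
rewrite serMl; last exact: pentagonal_theta_small.
apply: eq_ser => n; rewrite /pentagonal_theta mulrA -exprD.
by congr (q ^+ _ * (1 - q ^+ _)); rewrite ?bin2S; lia.
Qed.

End Sums.

(** * The sums behind C5, E2 and E4 *)

Section MoreSums.
Variable R : comUnitRingType.
Local Notation q := (fpsX R).
Local Notation p := (qpoch q q).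
Local Notation o := (qpoch q (q ^+ 2)).
Local Notation e := (qpoch (q ^+ 2) (q ^+ 2)).
Local Notation P := (qpoch_inf q q).
Local Notation O := (qpoch_inf q (q ^+ 2)).
Local Notation E := (qpoch_inf (q ^+ 2) (q ^+ 2)).

Lemma eqmod_eqr k (f g h : fps R) : g = h -> fps_eqmod k f g -> fps_eqmod k f h.
Proof. by move=> ->. Qed.

(** Here and in the next two lemmas a, b, c, d stand for O, E, P, P^-1, abstracted for the same
    reason as in [limit_even]. *)
Lemma limit_gauss (a b c d : fps R) : c = a * b -> c * d = 1 -> a * c * (b * d * d) = 1.
Proof.
move=> cE cd; transitivity ((a * b) * d * (c * d)); first by ring.
by rewrite -cE cd !mulr1.
Qed.

Lemma limit_kummer (a b c d x : fps R) : b * x = c -> c * d = 1 ->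
  b * (1 * (a * d * x)) = a.
Proof.
by move=> <- H; transitivity (a * (b * x * d)); [ring | rewrite H mulr1].
Qed.

Lemma limit_hecke (a b c d u v x x' s s' h : fps R) : c = a * b -> c * d = 1 ->
  u * x * s + v * x' * s' = a * d * d * h ->
  u * (b * c * (x * s)) + v * (b * c * (x' * s')) = h.
Proof.
move=> cE cd H; transitivity (b * c * (u * x * s + v * x' * s')); first by ring.
rewrite H; transitivity ((a * b) * d * (c * d) * h); first by ring.
by rewrite -cE cd !mul1r.
Qed.

Definition gauss_term r m : fps R :=
  q ^+ ('C(m.+1, 2) + m * r) * e (m + r) * (p (m + r))^-1 * (p m)^-1
  * (p (m + (2 * r + 1)))^-1.

Lemma gauss_term_small r : small (gauss_term r).
Proof.
move=> m; do 4 apply: ord_geMl; apply: ord_ge_Xle.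
by apply: leq_trans (leq_addr _ _); exact: leq_bin2S.
Qed.

(** A case of the 1phi1 limit of the q-Gauss sum, with a = -q^(r+1) and c = q^(2r+2). The sum is
    constant in r, and for large r only m = 0 contributes, with limit E / P^2. *)
Lemma ser_gauss_term r : O * P * ser (gauss_term r) = 1.
Proof.
apply: (@constant_limit _ (fun r => O * P * ser (gauss_term r))) => {r} r; last first.
  apply: (eqmod_eqr (limit_gauss (euler_inf_double R) (eulerVK R))).
  apply: eqmodM; first exact: eqmod_refl.
  apply: ser_head_eqmod; first exact: gauss_term_small.
    rewrite /gauss_term (_ : 'C(1, 2) + 0 * r = 0)%N// !add0n qpoch0 invr1 mulr1 mul1r.
    apply: eqmodM; last by apply: eulerV_eqmod; lia.
    by apply: eqmodM; [apply: even_eqmod | apply: eulerV_eqmod]; lia.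
  by move=> m; do 4 apply: ord_geMl; apply: ord_ge_Xle; nia.
suff H : ser (gauss_term r) + -1 * ser (gauss_term r.+1) = 0.
  by congr (_ * _); apply/eqP; rewrite -subr_eq0 -H mulN1r.
rewrite serMl; last exact: gauss_term_small.
rewrite -serD; apply: (@ser_telescope _ _ (fun M =>
  - q ^+ ('C(M.+2, 2) + M.+1 * r) * e (M + r) * (p (M + r))^-1 * (p M)^-1
  * (p (M + (2 * r + 3)))^-1
  * ((1 + q ^+ (M + r.+1)) * (1 + (q ^+ r.+1 - q ^+ (2 * r + 2)) * q ^+ M.+1)))).
- rewrite /gauss_term (_ : 'C(1, 2) + 0 * r = 0)%N// !add0n.
  rewrite (_ : 2 * r.+1 + 1 = 2 * r + 3)%N; last by lia.
  rewrite !addnS !addn0 qpoch_evenS [(p r)^-1]eulerV [(p (2 * r).+1)^-1]eulerV.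
  rewrite [(p (2 * r).+2)^-1]eulerV qpoch0 invr1.
  move: (p r.+1)^-1 (p (2 * r).+3)^-1 (e r) => a b c; rewrite binn; expand_q.
  by move: (q ^+ r) => x; ring.
- move=> m; rewrite /gauss_term (_ : 2 * r.+1 + 1 = (2 * r).+3)%N; last by lia.
  rewrite (mulnS m.+1 r) !addnS !addSn !addn0.
  rewrite (qpoch_evenS _ (m + r).+1) (qpoch_evenS _ (m + r)).
  rewrite [(p (m + r))^-1]eulerV [(p (m + r).+1)^-1]eulerV [(p m)^-1]eulerV.
  rewrite [(p (m + 2 * r).+2)^-1]eulerV [(p (m + 2 * r).+3)^-1]eulerV.
  move: (p (m + r).+2)^-1 (p m.+1)^-1 (p (m + 2 * r).+4)^-1 (e (m + r)) => a b c d.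
  rewrite !bin2S; expand_q.
  by move: (q ^+ m) (q ^+ r) (q ^+ (m * r)) (q ^+ 'C(m, 2)) => x y s t; ring.
move=> M; apply: eqmod_ord_ge; do 5 apply: ord_geMl.
apply/ord_geN/ord_ge_Xle.
by apply: leq_trans (leq_addr _ _); exact: leq_bin2S.
Qed.

Definition exp_term j m : fps R := (-1) ^+ m * q ^+ (j * m) * (p m)^-1.

Lemma exp_term_small j : (0 < j)%N -> small (exp_term j).
Proof. by move=> j0 m; apply/ord_geMl/ord_geMr/ord_ge_Xle; exact: leq_pmull. Qed.

(** Functional equation of Euler's series for 1/(-q^j;q)_oo: in the difference of the two summands
    the factor 1 - q^m cancels against (q;q)_m, and shifting m gives -q^j times the series at j. *)
Lemma ser_exp_termS j : (0 < j)%N ->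
  ser (exp_term j.+1) = (1 + q ^+ j) * ser (exp_term j).
Proof.
move=> j0; have sj := exp_term_small j0.
rewrite mulrDl mul1r (serMl _ sj).
have s0 : small (fun m => exp_term j m - exp_term j.+1 m).
  by move=> m; apply: ord_geD; [| apply: ord_geN]; exact: exp_term_small.
rewrite (@eq_ser _ (exp_term j) (fun m => exp_term j.+1 m + (exp_term j m - exp_term j.+1 m))).
  rewrite serD (ser_recl s0) /exp_term !muln0 subrr add0r -addrA -serD.
  rewrite -[LHS]addr0; congr (_ + _); apply/esym/fpsP => n.
  rewrite [LHS]/= big1 => [|i _]; first by rewrite !fps_coef0.
  rewrite (eulerV _ i); expand_q.
  by ring.
by move=> m; rewrite addrC subrK.
Qed.

Lemma ser_exp_term1 : E * ser (exp_term 1) = P.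
Proof.
have H n : e n * ser (exp_term 1) = p n * ser (exp_term n.+1).
  elim: n => [|n IHn]; first by rewrite !qpoch0.
  rewrite qpoch_evenS mulrAC IHn [in RHS]ser_exp_termS// eulerS.
  by move: (ser _) (p n) => a b; expand_q; ring.
apply: eqmodP => n; apply: (@eqmod_trans _ _ (e n * ser (exp_term 1))).
  by apply: eqmodM; [apply/eqmod_sym/even_eqmod; lia | exact: eqmod_refl].
rewrite H -[X in fps_eqmod _ _ X]mulr1; apply: eqmodM; first by apply: euler_eqmod; lia.
apply: ser_head_eqmod; first exact: exp_term_small.
  by rewrite /exp_term muln0 qpoch0 invr1 !mulr1; exact: eqmod_refl.
by move=> m; apply/ord_geMl/ord_geMr/ord_ge_Xle; nia.
Qed.

Definition kummer_term r m : fps R :=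
  (-1) ^+ m * q ^+ m * o (m + r) * (p m)^-1 * (p (m + (2 * r + 1)))^-1.

Lemma kummer_term_small r : small (kummer_term r).
Proof. by move=> m; do 3 apply: ord_geMl; apply/ord_geMr/ord_ge_Xle. Qed.

(** The q-Gauss sum with a, b = q^(r+1/2), -q^(r+1/2) and c = q^(2r+2), proved without half-integral
    powers. Here q^m does not decay with r, so the limit keeps every m: it is O/P times Euler's
    series [exp_term 1]. *)
Lemma ser_kummer_term r : E * ((1 - q ^+ (2 * r + 1)) * ser (kummer_term r)) = O.
Proof.
apply: (@constant_limit _
  (fun r => E * ((1 - q ^+ (2 * r + 1)) * ser (kummer_term r)))) => {r} r; last first.
  apply: (eqmod_eqr (limit_kummer O ser_exp_term1 (eulerVK R))).
  rewrite (serMl _ (exp_term_small (ltn0Sn 0))).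
  apply: eqmodM; first exact: eqmod_refl.
  apply: eqmodM; first by apply/eqmod_1D/ord_geN/ord_ge_Xle; lia.
  apply: ser_eqmod_ext => m; rewrite /kummer_term /exp_term mul1n.
  have -> : O * P^-1 * ((-1) ^+ m * q ^+ m * (p m)^-1)
     = (-1) ^+ m * q ^+ m * O * (p m)^-1 * P^-1.
    by move: O (p m)^-1 P^-1 (_ * q ^+ m) => a b c d; ring.
  apply: eqmodM; last by apply: eulerV_eqmod; lia.
  apply: eqmodM; last exact: eqmod_refl.
  by apply: eqmodM; [exact: eqmod_refl | apply: odd_eqmod; lia].
suff H : (1 - q ^+ (2 * r + 1)) * ser (kummer_term r)
       + - (1 - q ^+ (2 * r.+1 + 1)) * ser (kummer_term r.+1) = 0.
  by congr (_ * _); apply/eqP; rewrite -subr_eq0 -H mulNr.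
do 2 (rewrite serMl; last exact: kummer_term_small).
rewrite -serD; apply: (@ser_telescope _ _ (fun M =>
  (-1) ^+ M.+1 * q ^+ M.+1 * o (M + r) * (p M)^-1 * (p (M + (2 * r + 3)))^-1
  * ((1 - q ^+ (2 * (M + r) + 1)) * q ^+ (2 * r + 1)
     * (1 - q + q ^+ M.+1 - q ^+ (2 * r + M + 3))))).
- rewrite /kummer_term !add0n (_ : 2 * r.+1 + 1 = 2 * r + 3)%N; last by lia.
  rewrite !addnS !addn0 qpoch_oddS [(p (2 * r).+1)^-1]eulerV.
  rewrite [(p (2 * r).+2)^-1]eulerV qpoch0 invr1.
  move: (p (2 * r).+3)^-1 (o r) => b c; expand_q.
  by move: (q ^+ r) => x; ring.
- move=> m; rewrite /kummer_term (_ : 2 * r.+1 + 1 = (2 * r).+3)%N; last by lia.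
  rewrite !addnS !addSn !addn0.
  rewrite (qpoch_oddS _ (m + r).+1) (qpoch_oddS _ (m + r)) [(p m)^-1]eulerV.
  rewrite [(p (m + 2 * r).+2)^-1]eulerV [(p (m + 2 * r).+3)^-1]eulerV.
  move: (p m.+1)^-1 (p (m + 2 * r).+4)^-1 (o (m + r)) => a b d.
  expand_q.
  by move: (q ^+ m) (q ^+ r) ((-1) ^+ m) => x y s; ring.
move=> M; apply: eqmod_ord_ge; do 4 apply: ord_geMl.
by apply/ord_geMr/ord_ge_Xle.
Qed.

Definition hecke_term r m : fps R :=
  q ^+ (2 * m) * o (m + r) * (p m)^-1 * (p (m + (2 * r + 1)))^-1.

Lemma hecke_term_small r : small (hecke_term r).
Proof. by move=> m; do 3 apply: ord_geMl; apply: ord_ge_Xle; lia. Qed.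

(* [\sum_n (-1)^n q^(n^2) x^n (1 - q^(2n+1))] at [x = q^(2r+1)] *)
Definition square_theta r n : fps R :=
  (-1) ^+ n * q ^+ (n * n + (2 * r + 1) * n) * (1 - q ^+ (2 * n + 1)).

Lemma square_theta_small r : small (square_theta r).
Proof. by move=> n; apply/ord_geMl/ord_geMr/ord_ge_Xle; nia. Qed.

(** The recurrence found by creative telescoping is (1 + q^(2r+3)) F r + B r * F r.+1 = A r. Its
    leading coefficient is a unit, and [solve] divides by it to reach the form of
    [recurrence_unique]. *)
Lemma ser_hecke_term r :
  E * P * ((1 - q ^+ (2 * r + 1)) * ser (hecke_term r)) = ser (square_theta r).
Proof.
have U r' : (1 + q ^+ (2 * r' + 3)) \is a GRing.unit.
  by rewrite fps_unitE fps_coefD addn3 (@ord_ge_X _ (2 * r').+3 0)// addr0 unitr1.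
pose B r' : fps R := q ^+ (2 * r' + 4) * (1 + q ^+ (2 * r' + 1)).
pose A r' : fps R := (1 - q) * (1 - q ^+ (2 * r' + 2)).
have solve F : (forall r', (1 + q ^+ (2 * r' + 3)) * F r' + B r' * F r'.+1 = A r') ->
    forall r', F r' = (1 + q ^+ (2 * r' + 3))^-1 * A r'
                      + - ((1 + q ^+ (2 * r' + 3))^-1 * B r') * F r'.+1.
  move=> FE r'; apply: (mulrI (U r')).
  rewrite mulrDr mulVKr// mulNr mulrN -mulrA mulVKr// -FE.
  by rewrite addrK.
apply: (recurrence_unique
  (F := fun r => E * P * ((1 - q ^+ (2 * r + 1)) * ser (hecke_term r)))
  (G := fun r => ser (square_theta r)) _ (solve _ _) (solve _ _)) => {r} r.
- by apply/ord_geN/ord_geMr/ord_geMl/ord_ge_Xle; lia.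
- apply: (limit_hecke (euler_inf_double R) (eulerVK R)).
  do 2 (rewrite serMl; last exact: hecke_term_small).
  rewrite -serD; apply: (@ser_telescope _ _ (fun M =>
    o (M + r) * (p M)^-1 * (p (M + (2 * r + 3)))^-1
    * ((1 - q ^+ (2 * (M + r) + 1))
       * (A r + ((1 + q ^+ (2 * r + 3)) * (1 - q ^+ (2 * r + 2))
                 + q ^+ (4 * r + 4 + M) * (1 - q ^+ 2)) * q ^+ M.+1)))).
  + rewrite /hecke_term /A /B !add0n (_ : 2 * r.+1 + 1 = 2 * r + 3)%N; last by lia.
    rewrite !addnS !addn0 qpoch_oddS [(p (2 * r).+1)^-1]eulerV.
    rewrite [(p (2 * r).+2)^-1]eulerV qpoch0 invr1 (_ : 4 * r = r + r + (r + r))%N; last by lia.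
    move: (p (2 * r).+3)^-1 (o r) => b c; expand_q.
    by move: (q ^+ r) => x; ring.
  + move=> m; rewrite /hecke_term /A /B (_ : 2 * r.+1 + 1 = (2 * r).+3)%N; last by lia.
    rewrite (mulnS 2 m) !addnS !addSn !addn0.
    rewrite (qpoch_oddS _ (m + r).+1) (qpoch_oddS _ (m + r)) [(p m)^-1]eulerV.
    rewrite [(p (m + 2 * r).+2)^-1]eulerV [(p (m + 2 * r).+3)^-1]eulerV.
    move: (p m.+1)^-1 (p (m + 2 * r).+4)^-1 (o (m + r)) => a b d.
    rewrite (_ : 4 * r = r + r + (r + r))%N; last by lia.
    expand_q.
    by move: (q ^+ m) (q ^+ r) => x y; ring.
  move=> M; apply: eqmodM.
    apply: eqmodM; last by apply: eulerV_eqmod; lia.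
    by apply: eqmodM; [apply: odd_eqmod | apply: eulerV_eqmod]; lia.
  rewrite -[A r in X in fps_eqmod _ _ X]mul1r.
  apply: eqmodM; first by apply/eqmod_1D/ord_geN/ord_ge_Xle; lia.
  rewrite -[X in fps_eqmod _ _ X]addr0; apply: eqmodD; first exact: eqmod_refl.
  exact/eqmod_ord_ge/ord_geMr/ord_ge_X.
(* Shifting n changes the factor 1 - q^(2n+1) into 1 - q^(2n+3), so removing the first term does not
   lead to the series at r.+1; the theta side is telescoped as well. *)
do 2 (rewrite serMl; last exact: square_theta_small).
rewrite -serD; apply: (@ser_telescope _ _ (fun M => A r
  + (-1) ^+ M.+1 * q ^+ (M.+1 * M.+1 + (2 * r + 1) * M.+1)
    * (q * (1 + q ^+ (2 * r + 1)) * q ^+ (2 * M.+1) - (1 + q ^+ (2 * r + 3))))).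
- rewrite /square_theta /A /B !muln0 !muln1; expand_q.
  by move: (q ^+ r) => x; ring.
- move=> m; rewrite /square_theta /A /B; expand_q.
  by move: (q ^+ m) (q ^+ r) (q ^+ (m * m)) (q ^+ (r * m)) ((-1) ^+ m) => x y a b s; ring.
move=> M; rewrite -[X in fps_eqmod _ _ X]addr0; apply: eqmodD; first exact: eqmod_refl.
by apply/eqmod_ord_ge/ord_geMl/ord_geMr/ord_ge_Xle; nia.
Qed.

End MoreSums.

(** * Evaluation of the inner series in the eight cases *)

Section Inner.
Variable R : comUnitRingType.
Local Notation q := (fpsX R).
Local Notation p := (qpoch q q).
Local Notation o := (qpoch q (q ^+ 2)).
Local Notation e := (qpoch (q ^+ 2) (q ^+ 2)).
Local Notation P := (qpoch_inf q q).
Local Notation O := (qpoch_inf q (q ^+ 2)).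
Local Notation E := (qpoch_inf (q ^+ 2) (q ^+ 2)).

Lemma euler_tail n : p n * qpoch_inf (q ^+ (n + 1)) q = P.
Proof. by rewrite addn1 exprS -qpoch_infD. Qed.

Lemma odd_tail n : o n * qpoch_inf (q ^+ (2 * n + 1)) (q ^+ 2) = O.
Proof. by rewrite addn1 (exprS q (2 * n)) exprM -qpoch_infD//; exact: fpsX2_coef0. Qed.

Lemma even_tail n : e n * qpoch_inf (q ^+ (2 * n + 2)) (q ^+ 2) = E.
Proof. by rewrite (addnC (2 * n)%N) exprD exprM -qpoch_infD//; exact: fpsX2_coef0. Qed.

Lemma ser_innerE (d t : nat -> fps R) r L : small t ->
  (forall m, d (m + r)%N * p (2 * (m + r)) * (p m)^-1 * (p (m + (2 * r + 1)))^-1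
             = L * t m) ->
  ser (inner_term d r) = L * ser t.
Proof.
move=> t0 dt; rewrite serMl//; apply: eq_ser => m.
by rewrite -dt /inner_term invrM ?euler_unit// -!mulrA [(p m)^-1 * _]mulrC.
Qed.

Lemma absorb_tail (x a b c f g : fps R) : b * a = c -> x * a * b * f * g = c * (x * f * g).
Proof. by move=> <-; ring. Qed.

Lemma inner_A1 r :
  ser (inner_term (fun n => q ^+ n * qpoch_inf (q ^+ (2 * n + 1)) q) r)
  = P * q ^+ r * ser (heine_term R 1 (2 * r + 1)).
Proof.
apply: ser_innerE => [|m]; first exact: heine_term_small.
rewrite (absorb_tail _ _ _ (euler_tail _)) -[RHS]mulrA; congr (_ * _).
by rewrite /heine_term mul1n exprD; ring.
Qed.

Lemma inner_A3 r :
  ser (inner_term (fun n => q ^+ (2 * n) * qpoch_inf (q ^+ (2 * n + 1)) q) r)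
  = P * q ^+ (2 * r) * ser (heine_term R 2 (2 * r + 1)).
Proof.
apply: ser_innerE => [|m]; first exact: heine_term_small.
rewrite (absorb_tail _ _ _ (euler_tail _)) -[RHS]mulrA; congr (_ * _).
by rewrite /heine_term mulnDr exprD; ring.
Qed.

Lemma inner_A5 r :
  ser (inner_term (fun n => q ^+ (n ^ 2 + n) * qpoch_inf (q ^+ (2 * n + 1)) q) r)
  = q ^+ (r * r + r).
Proof.
transitivity (P * q ^+ (r * r + r) * ser (cauchy_term R (2 * r + 1) (2 * r + 1))); last first.
  by rewrite mulrAC ser_cauchy mul1r.
apply: ser_innerE => [|m]; first exact: cauchy_term_small.
rewrite (absorb_tail _ _ _ (euler_tail _)) -[RHS]mulrA; congr (_ * _).
rewrite /cauchy_term !mulrA -exprD; congr (q ^+ _ * _ * _); nia.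
Qed.

(** From (m+r)^2 = m^2 + 2rm + r^2 the linear exponent is 2r, one less than the shift 2r + 1 of the
    denominator; in A5 the extra m + r makes the two equal. *)
Lemma inner_A7 r :
  ser (inner_term (fun n => q ^+ (n ^ 2) * qpoch_inf (q ^+ (2 * n + 1)) q) r)
  = q ^+ (r * r) * (1 + q ^+ (2 * r + 1)).
Proof.
transitivity (P * q ^+ (r * r) * ser (cauchy_term R (2 * r) (2 * r + 1))); last first.
  by rewrite addn1 mulrAC ser_cauchy_pred mulrC.
apply: ser_innerE => [|m]; first exact: cauchy_term_small.
rewrite (absorb_tail _ _ _ (euler_tail _)) -[RHS]mulrA; congr (_ * _).
rewrite /cauchy_term !mulrA -exprD; congr (q ^+ _ * _ * _); nia.
Qed.

(** Of (q;q)_(2n) = (q;q^2)_n (q^2;q^2)_n the odd half completes the tail to O, and the even half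
    remains. Completing the other tail to P costs 1/(q;q)_n. *)
Lemma odd_euler_tail_absorb n (x f g : fps R) :
  x * qpoch_inf (q ^+ (2 * n + 1)) (q ^+ 2) * qpoch_inf (q ^+ (n + 1)) q * p (2 * n) * f * g
  = O * P * (x * e n * (p n)^-1 * f * g).
Proof.
have := euler_double R n; have := odd_tail n; have := euler_tail n.
have := divrr (euler_unit R n).
move: (p n) (p n)^-1 (p (2 * n)) (qpoch_inf (q ^+ (n + 1)) q) P => pn pi p2 t c.
move: (o n) (e n) O (qpoch_inf (q ^+ (2 * n + 1)) (q ^+ 2)) => on en b s H <- <- ->.
transitivity ((pn * pi) * (x * s * t * (on * en) * f * g)); last by ring.
by rewrite H mul1r.
Qed.

Lemma inner_C1 r :
  ser (inner_term (fun n => q ^+ n * qpoch_inf (q ^+ (2 * n + 1)) (q ^+ 2)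
                            * qpoch_inf (q ^+ (n + 1)) q) r)
  = O * P * q ^+ r * ser (rogers_term R r).
Proof.
apply: ser_innerE => [|m]; first exact: rogers_term_small.
rewrite odd_euler_tail_absorb -[RHS]mulrA; congr (_ * _).
by rewrite /rogers_term exprD; ring.
Qed.

Lemma inner_C5 r :
  ser (inner_term (fun n => q ^+ ((n ^ 2 + n) %/ 2)
     * qpoch_inf (q ^+ (2 * n + 1)) (q ^+ 2) * qpoch_inf (q ^+ (n + 1)) q) r)
  = q ^+ 'C(r.+1, 2).
Proof.
transitivity (O * P * q ^+ 'C(r.+1, 2) * ser (gauss_term R r)); last first.
  by rewrite mulrAC ser_gauss_term mul1r.
apply: ser_innerE => [|m]; first exact: gauss_term_small.
rewrite odd_euler_tail_absorb -[RHS]mulrA; congr (_ * _).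
rewrite /gauss_term !mulrA -exprD; congr (q ^+ _ * _ * _ * _ * _).
have H n : ((n ^ 2 + n) %/ 2 = 'C(n.+1, 2))%N.
  by rewrite divn2 bin2 /= mulSn -mulnn addnC.
rewrite H; elim: m => [|m IHm]; first by rewrite addn0.
by rewrite addSn bin2S IHm (bin2S m.+1); lia.
Qed.

Lemma even_tail_absorb n (x f g : fps R) :
  x * qpoch_inf (q ^+ (2 * n + 2)) (q ^+ 2) * p (2 * n) * f * g = E * (x * o n * f * g).
Proof.
have := euler_double R n; have := even_tail n.
move: (p (2 * n)) (o n) (e n) E (qpoch_inf (q ^+ (2 * n + 2)) (q ^+ 2)) => p2 on en b s.
by move=> <- ->; ring.
Qed.

Lemma inner_E2 r :
  ser (inner_term (fun n => (-1) ^+ n * q ^+ n * qpoch_inf (q ^+ (2 * n + 2)) (q ^+ 2)) r)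
  = E * ((-1) ^+ r * q ^+ r) * ser (kummer_term R r).
Proof.
apply: ser_innerE => [|m]; first exact: kummer_term_small.
rewrite even_tail_absorb -[RHS]mulrA; congr (_ * _).
by rewrite /kummer_term !exprD; ring.
Qed.

Lemma inner_E4 r :
  ser (inner_term (fun n => q ^+ (2 * n) * qpoch_inf (q ^+ (2 * n + 2)) (q ^+ 2)) r)
  = E * q ^+ (2 * r) * ser (hecke_term R r).
Proof.
apply: ser_innerE => [|m]; first exact: hecke_term_small.
rewrite even_tail_absorb -[RHS]mulrA; congr (_ * _).
by rewrite /hecke_term mulnDr exprD; ring.
Qed.

(** Pairing term j.+1 with q^N times term j produces the factor 1 + q^n, n = j.+1, in the statement
    of A1. *)
Lemma partial_theta_1B N : (1 - q ^+ N) * ser (partial_theta R N) =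
  1 + ser (fun j => (-1) ^+ j.+1 * q ^+ (N * j.+1 + 'C(j.+1, 2)) * (1 + q ^+ j.+1)).
Proof.
have s0 := @partial_theta_small R N.
rewrite mulrBl mul1r (serMl _ s0) (ser_recl s0) {1}/partial_theta.
rewrite muln0 !expr0 mul1r -addrA; congr (_ + _).
rewrite -mulN1r serMl => [|m]; last exact/ord_geMr/s0.
rewrite -serD; apply: eq_ser => j; rewrite /partial_theta !bin2S; expand_q.
by move: (q ^+ N) (q ^+ (N * j)) (q ^+ 'C(j, 2)) (q ^+ j) => a b c d; ring.
Qed.

End Inner.

(** * From integer exponents to natural ones *)

Section Exponents.

Lemma half_int (x y : int) : x = 2 * y -> (x %/ 2)%Z = y.
Proof. by move=> ->; rewrite mulKz. Qed.

Lemma bin2_int (n : nat) : n%:Z * (n%:Z - 1) = 2 * 'C(n, 2)%:Z.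
Proof. by elim: n => // n IHn; rewrite bin2S; lia. Qed.

Variables (R : comUnitRingType) (z : fps R).

Lemma zfactor_int (r : nat) :
  (1 - z ^ (r.+1%:Z - 1)) * (1 - z ^ r.+1%:Z) * z ^ (1 - r.+1%:Z) = zfactor z r.
Proof.
rewrite /zfactor (_ : r.+1%:Z - 1 = r); last by lia.
by rewrite (_ : 1 - r.+1%:Z = - r%:Z) -?exprz_inv//; lia.
Qed.

Hypothesis zU : z \is a GRing.unit.

(** The z-factor is invariant under r -> -r-1, which is why the bilateral sums fold onto r >= 0. *)
Lemma zfactor_opp (r : nat) :
  (1 - z ^ (- r%:Z)) * (1 - z ^ (- r.+1%:Z)) * z ^ r.+1%:Z = zfactor z r.
Proof.
have H n : z ^+ n * z^-1 ^+ n = 1 by rewrite -exprMn divrr// expr1n.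
rewrite /zfactor -!exprz_inv -!exprnP.
move: (z ^+ r.+1) (z^-1 ^+ r.+1) (H r.+1) (z ^+ r) (z^-1 ^+ r) (H r) => a b ab c d cd.
transitivity ((1 - d) * (a - a * b)); first by ring.
rewrite ab; transitivity ((1 - a) * (d - c * d)); last by ring.
by rewrite cd; ring.
Qed.

Lemma sign_int (n : int) (m : nat) : odd `|n| = odd m -> ((-1) ^ n : fps R) = (-1) ^+ m.
Proof.
rewrite -(signr_odd _ m) => <-; rewrite signr_odd; case: n => n //.
by rewrite NegzE -exprnN invr_sign.
Qed.

End Exponents.

(** * The eight identities *)

Section Main.
Variables (R : comUnitRingType) (z : fps R).
Hypothesis zU : z \is a GRing.unit.
Local Notation q := (fpsX R).
Local Notation P := (qpoch_inf q q).
Local Notation O := (qpoch_inf q (q ^+ 2)).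
Local Notation E := (qpoch_inf (q ^+ 2) (q ^+ 2)).

Lemma divide_out (c d s t x w b : fps R) :
  c * d = 1 -> c * c * (b * s) = t -> x * b * (c * w * s) = d * (x * w * t).
Proof.
move=> cd <-; transitivity ((c * d) * (x * b * (c * w * s))); last by ring.
by rewrite cd mul1r.
Qed.

Lemma identity_A1 : (1 + z) * qpoch2_inf z z^-1 q * S_A1 z q =
  P^-1 *
  \fsum_(k \in [set k : int | 1 <= k])
    ((1 - z ^ (k - 1)) * (1 - z ^ k) * z ^ (1 - k) *
     ((-1) ^ (k + 1) * q ^ (k * (k - 1) %/ 2)%Z +
      \fsum_(n \in [set n : int | 1 <= n])
        ((-1) ^ (n + k + 1)
         * q ^ ((k * (k - 1) %/ 2)%Z + (n * (n - 3) %/ 2)%Z + 2 * k * n)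
         * (1 + q ^ n)))).
Proof.
rewrite /S_A1 (bailey_expansion zU) => [|n]; last exact/ord_geMl/ord_ge_X.
pose T N j : fps R := (-1) ^+ j.+1 * q ^+ (N * j.+1 + 'C(j.+1, 2)) * (1 + q ^+ j.+1).
have T0 N : (0 < N)%N -> small (T N).
  by move=> N0 n; apply/ord_geMl/ord_geMr/ord_ge_Xle; nia.
pose G r := (-1) ^+ r * q ^+ 'C(r, 2) * zfactor z r * q ^+ r * (1 + ser (T (2 * r + 1)%N)).
have G0 : small G by move=> n; apply/ord_geMl/ord_geMr/ord_ge_X.
rewrite (@fps_sum_int_ge1 _ _ G)//.
  rewrite serMl//; apply: eq_ser => r; rewrite inner_A1 /G.
  rewrite (mulrAC _ (1 - _) (zfactor _ _)).
  apply: divide_out; first exact: eulerVK.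
  by rewrite mulrCA ser_heine_term1 partial_theta_1B.
move=> r; rewrite zfactor_int /G -[RHS]mulrA [RHS]mulrAC [RHS]mulrC; congr (_ * _).
have Ek : (r.+1%:Z * (r.+1%:Z - 1) %/ 2)%Z = 'C(r.+1, 2) by apply/half_int/bin2_int.
rewrite (@fps_sum_int_ge1 _ _ (fun j => (-1) ^+ r * q ^+ 'C(r.+1, 2) * T (2 * r + 1)%N j)).
- rewrite -serMl; last by apply: T0; lia.
  rewrite Ek (@sign_int _ _ r); last by lia.
  rewrite -exprnP bin2S exprD.
  by move: (ser _) (q ^+ 'C(r, 2)) (q ^+ r) ((-1) ^+ r) => a b c d; ring.
(* With n = j.+1, n(n-3)/2 = 'C(n, 2) - n is negative for n = 1 and n = 2, so exponents are added as
   integers and only the total, where 2kn compensates, is made natural. *)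
- move=> j; rewrite Ek (@half_int _ ('C(j.+1, 2)%:Z - j.+1%:Z)); last by have := bin2_int j.+1; lia.
  rewrite (@sign_int _ _ (r + j.+1)); last by lia.
  rewrite (_ : _ + _ = ('C(r.+1, 2) + ((2 * r + 1) * j.+1 + 'C(j.+1, 2)))%N%:Z); last by nia.
  rewrite -!exprnP /T !exprD.
  move: (q ^+ _) (q ^+ _) (q ^+ _) ((-1) ^+ r) ((-1) ^+ j.+1) => a b c d f.
  by ring.
by move=> j; apply/ord_geMr/T0; lia.
Qed.


Lemma identity_A3 : (1 + z) * qpoch2_inf z z^-1 q * S_A3 z q =
  P^-1 *
  \fsum_(k \in [set k : int | 1 <= k]) \fsum_(n \in [set n : int | 0 <= n])
    ((1 - z ^ (k - 1)) * (1 - z ^ k) * z ^ (1 - k) * (-1) ^ (n + k + 1)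
     * q ^ ((k * (k + 1) %/ 2)%Z + (n * (n - 3) %/ 2)%Z + 2 * k * n - 1)
     * (1 - q ^ (2 * n + 1))).
Proof.
rewrite /S_A3 (bailey_expansion zU) => [|n]; last by apply/ord_geMl/ord_ge_Xle; lia.
pose C r := (-1) ^+ r * q ^+ 'C(r, 2) * zfactor z r * q ^+ (2 * r).
have T0 r : small (partial_theta3 R (2 * r + 1)) by apply: partial_theta3_small; lia.
pose G r := C r * ser (partial_theta3 R (2 * r + 1)).
have G0 : small G by move=> n; apply/ord_geMl/ord_geMr/ord_ge_Xle; lia.
rewrite (@fps_sum_int_ge1 _ _ G)//.
  rewrite serMl//; apply: eq_ser => r; rewrite inner_A3 /G.
  rewrite (mulrAC _ (1 - _) (zfactor _ _)).
  apply: divide_out; first exact: eulerVK.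
  by rewrite ser_heine_term2//; lia.
move=> r; rewrite /G serMl//; apply: fps_sum_int_ge0 => [n|n]; last exact/ord_geMr/T0.
rewrite zfactor_int (@sign_int _ _ (r + n)); last by lia.
rewrite (@half_int (r.+1%:Z * _) ('C(r, 2) + 2 * r + 1)%N); last by have := bin2_int r; lia.
rewrite (@half_int _ ('C(n, 2)%:Z - n%:Z)); last by have := bin2_int n; lia.
rewrite (_ : _ - 1 = ('C(r, 2) + 2 * r + ((2 * r + 1) * n + 'C(n, 2)))%N%:Z); last by nia.
rewrite (_ : 2 * n%:Z + 1 = (2 * n + 1)%N%:Z)// /C /partial_theta3 -!exprnP !exprD.
move: (zfactor z r) (q ^+ 'C(r, 2)) (q ^+ (2 * r)) (q ^+ _) (q ^+ 'C(n, 2)) => a b c d f.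
by move: (q ^+ _) (q ^+ 1) ((-1) ^+ r) ((-1) ^+ n) => g h x y; ring.
Qed.

Lemma mulr_regroup (s a b c t : fps R) : s * a * b * c * t = s * t * (a * b * c).
Proof. by ring. Qed.

Lemma neq_oppS (n m : nat) : n%:Z != - m.+1%:Z.
Proof. by lia. Qed.

Lemma oppS_inj : injective (fun n : nat => - n.+1%:Z).
Proof. by move=> n m /eqP; rewrite eqr_opp => /eqP[]. Qed.

Lemma int_pairP (k : int) : exists n : nat, k = n%:Z \/ k = - n.+1%:Z.
Proof. by case: k => n; exists n; [left | right; rewrite NegzE]. Qed.

Lemma zfactor_pos (n : nat) :
  (1 - z ^ n%:Z) * (1 - z ^ (n%:Z + 1)) * z ^ (- n%:Z) = zfactor z n.
Proof. by rewrite -exprz_inv (_ : n%:Z + 1 = n.+1)//; lia. Qed.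

Lemma zfactor_neg (n : nat) :
  (1 - z ^ (- n.+1%:Z)) * (1 - z ^ (- n.+1%:Z + 1)) * z ^ (- - n.+1%:Z) = zfactor z n.
Proof.
rewrite opprK (_ : - n.+1%:Z + 1 = - n%:Z); last by lia.
by rewrite [_ * (1 - z ^ (- n%:Z))]mulrC (zfactor_opp zU).
Qed.

Lemma identity_A5 : (1 + z) * qpoch2_inf z z^-1 q * S_A5 z q =
  \fsum_(k \in [set: int])
    ((-1) ^ k * (1 - z ^ k) * (1 - z ^ (k + 1)) * z ^ (- k)
     * q ^ (k * (3 * k + 1) %/ 2)%Z).
Proof.
rewrite /S_A5 (bailey_expansion zU) => [|n]; last by apply/ord_geMl/ord_ge_Xle; nia.
(* The two terms of 1 - q^(2r+1) in the expansion become the terms k = r and k = -r-1 of the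
   bilateral sum. *)
pose u n := (-1) ^+ n * q ^+ ('C(n, 2) + (n * n + n)) * zfactor z n.
pose v n := (-1) ^+ n.+1 * q ^+ ('C(n, 2) + (n * n + n) + (2 * n + 1)) * zfactor z n.
rewrite (@fps_sum_int _ _ (fun n => n%:Z) (fun n => - n.+1%:Z) u v).
- apply: eq_ser => r; rewrite inner_A5 /u /v (exprD q ('C(r, 2) + _)) (exprD q 'C(r, 2)) exprS.
  move: (zfactor z r) (q ^+ _) (q ^+ (r * r + r)) (q ^+ _) ((-1) ^+ r) => a b c d s.
  by ring.
- by move=> n m [].
- exact: oppS_inj.
- exact: neq_oppS.
- exact: int_pairP.
- move=> n; rewrite mulr_regroup zfactor_pos /u (@half_int _ ('C(n, 2) + (n * n + n))%N)//.
  by have := bin2_int n; lia.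
- move=> n; rewrite mulr_regroup zfactor_neg /v (@sign_int _ _ n.+1); last by lia.
  rewrite (@half_int _ ('C(n, 2) + (n * n + n) + (2 * n + 1))%N)//.
  by have := bin2_int n; lia.
- by move=> n; apply/ord_geMl/ord_geMr/ord_ge_Xle; lia.
by move=> n; apply/ord_geMl/ord_geMr/ord_ge_Xle; lia.
Qed.

Lemma identity_A7 : (1 + z) * qpoch2_inf z z^-1 q * S_A7 z q =
  \fsum_(k \in [set: int])
    ((-1) ^ k * (1 - z ^ k) * (1 - z ^ (k + 1)) * z ^ (- k)
     * q ^ (k * (3 * k - 1) %/ 2)%Z).
Proof.
rewrite /S_A7 (bailey_expansion zU) => [|n]; last by apply/ord_geMl/ord_ge_Xle; nia.
pose u n := (-1) ^+ n * q ^+ ('C(n, 2) + n * n) * zfactor z n.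
(* Here (1 - q^(2r+1)) (1 + q^(2r+1)) = 1 - q^(4r+2) is split between k = r and k = -r-1. *)
pose v n := (-1) ^+ n.+1 * q ^+ ('C(n, 2) + n * n + (2 * n + 1 + (2 * n + 1))) * zfactor z n.
rewrite (@fps_sum_int _ _ (fun n => n%:Z) (fun n => - n.+1%:Z) u v).
- apply: eq_ser => r; rewrite inner_A7 /u /v (exprD q ('C(r, 2) + _)) (exprD q 'C(r, 2)) exprS.
  rewrite (exprD q (2 * r + 1)).
  move: (zfactor z r) (q ^+ 'C(r, 2)) (q ^+ (r * r)) (q ^+ _) ((-1) ^+ r) => a b c d s.
  by ring.
- by move=> n m [].
- exact: oppS_inj.
- exact: neq_oppS.
- exact: int_pairP.
- move=> n; rewrite mulr_regroup zfactor_pos /u (@half_int _ ('C(n, 2) + n * n)%N)//.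
  by have := bin2_int n; lia.
- move=> n; rewrite mulr_regroup zfactor_neg /v (@sign_int _ _ n.+1); last by lia.
  rewrite (@half_int _ ('C(n, 2) + n * n + (2 * n + 1 + (2 * n + 1)))%N)//.
  by have := bin2_int n; lia.
- by move=> n; apply/ord_geMl/ord_geMr/ord_ge_Xle; nia.
by move=> n; apply/ord_geMl/ord_geMr/ord_ge_Xle; nia.
Qed.


Lemma divide_out_odd (a c d s t x w b : fps R) :
  c * d = 1 -> a * c * c * s = t -> x * b * (a * c * w * s) = d * (x * w * b * t).
Proof.
move=> cd <-; transitivity ((c * d) * (x * b * (a * c * w * s))); last by ring.
by rewrite cd mul1r.
Qed.

Lemma identity_C1 : (1 + z) * qpoch2_inf z z^-1 q * S_C1 z q =
  P^-1 *
  \fsum_(k \in [set k : int | 1 <= k]) \fsum_(n \in [set n : int | 0 <= n])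
    ((1 - z ^ (k - 1)) * (1 - z ^ k) * z ^ (1 - k) * (-1) ^ (k + 1)
     * q ^ ((k * (k - 1) %/ 2)%Z + (n * (3 * n - 1) %/ 2)%Z + 3 * k * n)
     * (1 - q ^ (2 * k - 1)) * (1 - q ^ (k + n))).
Proof.
rewrite /S_C1 (bailey_expansion zU) => [|n]; last by do 2 apply: ord_geMl; exact: ord_ge_X.
pose C r := (-1) ^+ r * q ^+ 'C(r, 2) * zfactor z r * q ^+ r * (1 - q ^+ (2 * r + 1)).
have T0 := @pentagonal_theta_small R.
pose G r := C r * ser (pentagonal_theta R r).
have G0 : small G by move=> n; do 2 apply: ord_geMl; exact/ord_geMr/ord_ge_X.
rewrite (@fps_sum_int_ge1 _ _ G)//.
  rewrite serMl//; apply: eq_ser => r; rewrite inner_C1 /G.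
  rewrite (mulrAC _ (1 - _) (zfactor _ _)).
  by apply: divide_out_odd; [exact: eulerVK | exact: ser_rogers_term].
move=> r; rewrite /G serMl//; apply: fps_sum_int_ge0 => [n|n]; last exact/ord_geMr/T0.
rewrite zfactor_int (@sign_int _ _ r); last by lia.
rewrite (@half_int (r.+1%:Z * _) ('C(r, 2) + r)%N); last by have := bin2_int r; lia.
rewrite (@half_int _ (3 * 'C(n, 2) + n)%N); last by have := bin2_int n; lia.
rewrite (_ : _ + 3 * _ * _ = ('C(r, 2) + r + (3 * 'C(n, 2) + n + 3 * r.+1 * n))%N%:Z); last by nia.
rewrite (_ : 2 * _ - 1 = (2 * r + 1)%N%:Z); last by lia.
rewrite (_ : r.+1%:Z + n = (n + r.+1)%N%:Z); last by lia.
rewrite /C /pentagonal_theta -!exprnP (exprD q ('C(r, 2) + r)) (exprD q 'C(r, 2)).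
move: (zfactor z r) (q ^+ 'C(r, 2)) (q ^+ r) (q ^+ _) (q ^+ (2 * r + 1)) => a b c d f.
by move: (q ^+ _) ((-1) ^+ r) => g x; ring.
Qed.

Lemma identity_C5 : (1 + z) * qpoch2_inf z z^-1 q * S_C5 z q =
  \fsum_(k \in [set: int])
    ((1 - z ^ (k - 1)) * (1 - z ^ k) * z ^ (1 - k) * (-1) ^ k * q ^ (k ^+ 2)).
Proof.
rewrite /S_C5 (bailey_expansion zU) => [|n]; last first.
  do 2 apply: ord_geMl; apply: ord_ge_Xle; rewrite divn2 geq_half_double -addnn; nia.
pose u n := (-1) ^+ n * q ^+ (n * n) * zfactor z n.
pose v n := (-1) ^+ n.+1 * q ^+ (n * n + (2 * n + 1)) * zfactor z n.
rewrite (@fps_sum_int _ _ (fun n => - n%:Z) (fun n => n.+1%:Z) u v).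
- apply: eq_ser => r; rewrite inner_C5 /u /v (exprD q (r * r)) exprS.
  have -> : (r * r = 'C(r, 2) + 'C(r.+1, 2))%N by have := bin2_int r; rewrite bin2S; lia.
  rewrite (exprD q 'C(r, 2)).
  move: (zfactor z r) (q ^+ 'C(r, 2)) (q ^+ 'C(r.+1, 2)) (q ^+ _) ((-1) ^+ r) => a b c d s.
  by ring.
- by move=> n m /eqP; rewrite eqr_opp => /eqP[].
- by move=> n m [].
- by move=> n m; lia.
- by move=> [[|n]|n]; [exists 0; left | exists n; right | exists n.+1; left; rewrite NegzE].
- move=> n; rewrite (_ : - n%:Z - 1 = - n.+1%:Z); last by lia.
  rewrite (_ : 1 - - n%:Z = n.+1%:Z); last by lia.
  rewrite [_ * (1 - z ^ (- n%:Z))]mulrC (zfactor_opp zU) (@sign_int _ _ n); last by lia.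
  rewrite (_ : (- n%:Z) ^+ 2 = (n * n)%N%:Z); last by lia.
  by rewrite /u -exprnP; move: (zfactor z n) => a; ring.
- move=> n; rewrite zfactor_int (@sign_int _ _ n.+1)//.
  rewrite (_ : n.+1%:Z ^+ 2 = (n * n + (2 * n + 1))%N%:Z); last by lia.
  by rewrite /v -exprnP; move: (zfactor z n) (_ ^+ n.+1) => a s; ring.
- by move=> n; apply/ord_geMl/ord_geMr/ord_ge_Xle; nia.
by move=> n; apply/ord_geMl/ord_geMr/ord_ge_Xle; nia.
Qed.

(** Here x is the sign (-1)^r: one copy comes from the triple product and one from the summand of
    E2, whence a right-hand side without signs. *)
Lemma cancel_even_inf (a b s t x y w f : fps R) :
  x * x = 1 -> a * (b * s) = t -> x * y * b * f * (a * (x * w) * s) = t * (y * w * f).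
Proof.
move=> xx <-; transitivity (x * x * (a * (b * s) * (y * w * f))); first by ring.
by rewrite xx mul1r.
Qed.

Lemma identity_E2 : (1 + z) * qpoch2_inf z z^-1 q * S_E2 z q =
  O * \fsum_(k \in [set k : int | 1 <= k])
    ((1 - z ^ k) * (1 - z ^ (k - 1)) * z ^ (1 - k) * q ^ (k * (k - 1) %/ 2)%Z).
Proof.
rewrite /S_E2 (bailey_expansion zU) => [|n]; last exact/ord_geMl/ord_geMr/ord_ge_X.
pose G r := q ^+ 'C(r, 2) * q ^+ r * zfactor z r.
have G0 : small G by move=> n; exact/ord_geMl/ord_geMr/ord_ge_X.
rewrite (@fps_sum_int_ge1 _ _ G)// => [|r].
  rewrite serMl//; apply: eq_ser => r; rewrite inner_E2 /G.
  by apply: cancel_even_inf; [rewrite -expr2 sqrr_sign | exact: ser_kummer_term].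
rewrite [(1 - z ^ r.+1%:Z) * _]mulrC zfactor_int.
rewrite (@half_int (r.+1%:Z * _) ('C(r, 2) + r)%N); last by have := bin2_int r; lia.
by rewrite -exprnP exprD mulrC.
Qed.

Lemma divide_out_even (a c d s t x w b : fps R) :
  c * d = 1 -> a * c * (b * s) = t -> x * b * (a * w * s) = d * (x * w * t).
Proof.
move=> cd <-; transitivity ((c * d) * (x * b * (a * w * s))); last by ring.
by rewrite cd mul1r.
Qed.

Lemma identity_E4 : (1 + z) * qpoch2_inf z z^-1 q * S_E4 z q =
  P^-1 *
  \fsum_(k \in [set k : int | 1 <= k]) \fsum_(n \in [set n : int | 0 <= n])
    ((1 - z ^ (k - 1)) * (1 - z ^ k) * z ^ (1 - k) * (-1) ^ (k + n + 1)
     * q ^ ((k * (k + 1) %/ 2)%Z + n ^+ 2 - n + 2 * k * n - 1)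
     * (1 - q ^ (2 * n + 1))).
Proof.
rewrite /S_E4 (bailey_expansion zU) => [|n]; last by apply/ord_geMl/ord_ge_Xle; lia.
pose C r := (-1) ^+ r * q ^+ 'C(r, 2) * zfactor z r * q ^+ (2 * r).
have T0 := @square_theta_small R.
pose G r := C r * ser (square_theta R r).
have G0 : small G by move=> n; apply/ord_geMl/ord_geMr/ord_ge_Xle; lia.
rewrite (@fps_sum_int_ge1 _ _ G)//.
  rewrite serMl//; apply: eq_ser => r; rewrite inner_E4 /G.
  rewrite (mulrAC _ (1 - _) (zfactor _ _)).
  by apply: divide_out_even; [exact: eulerVK | exact: ser_hecke_term].
move=> r; rewrite /G serMl//; apply: fps_sum_int_ge0 => [n|n]; last exact/ord_geMr/T0.
rewrite zfactor_int (@sign_int _ _ (r + n)); last by lia.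
rewrite (@half_int (r.+1%:Z * _) ('C(r, 2) + 2 * r + 1)%N); last by have := bin2_int r; lia.
rewrite (_ : _ - 1 = ('C(r, 2) + 2 * r + (n * n + (2 * r + 1) * n))%N%:Z); last by nia.
rewrite (_ : 2 * n%:Z + 1 = (2 * n + 1)%N%:Z)// /C /square_theta -!exprnP.
rewrite (exprD q ('C(r, 2) + 2 * r)) (exprD q 'C(r, 2)) exprD.
move: (zfactor z r) (q ^+ 'C(r, 2)) (q ^+ (2 * r)) (q ^+ _) (q ^+ _) => a b c d f.
by move: ((-1) ^+ r) ((-1) ^+ n) => x y; ring.
Qed.

End Main.

Theorem theorem2p5 :
  let z := zser in
  let q := qser in
  (* A1 *)
  ((1 + z) * qpoch2_inf z z^-1 q * S_A1 z q =
     (qpoch_inf q q)^-1 *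
     \fsum_(k \in [set k : int | 1 <= k])
       ((1 - z ^ (k - 1)) * (1 - z ^ k) * z ^ (1 - k) *
        ((-1) ^ (k + 1) * q ^ (k * (k - 1) %/ 2)%Z +
         \fsum_(n \in [set n : int | 1 <= n])
           ((-1) ^ (n + k + 1)
            * q ^ ((k * (k - 1) %/ 2)%Z + (n * (n - 3) %/ 2)%Z + 2 * k * n)
            * (1 + q ^ n)))))
  /\
  (* A3 *)
  ((1 + z) * qpoch2_inf z z^-1 q * S_A3 z q =
     (qpoch_inf q q)^-1 *
     \fsum_(k \in [set k : int | 1 <= k]) \fsum_(n \in [set n : int | 0 <= n])
       ((1 - z ^ (k - 1)) * (1 - z ^ k) * z ^ (1 - k) * (-1) ^ (n + k + 1)
        * q ^ ((k * (k + 1) %/ 2)%Z + (n * (n - 3) %/ 2)%Z + 2 * k * n - 1)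
        * (1 - q ^ (2 * n + 1))))
  /\
  (* A5 *)
  ((1 + z) * qpoch2_inf z z^-1 q * S_A5 z q =
     \fsum_(k \in [set: int])
       ((-1) ^ k * (1 - z ^ k) * (1 - z ^ (k + 1)) * z ^ (- k)
        * q ^ (k * (3 * k + 1) %/ 2)%Z))
  /\
  (* A7 *)
  ((1 + z) * qpoch2_inf z z^-1 q * S_A7 z q =
     \fsum_(k \in [set: int])
       ((-1) ^ k * (1 - z ^ k) * (1 - z ^ (k + 1)) * z ^ (- k)
        * q ^ (k * (3 * k - 1) %/ 2)%Z))
  /\
  (* C1 *)
  ((1 + z) * qpoch2_inf z z^-1 q * S_C1 z q =
     (qpoch_inf q q)^-1 *
     \fsum_(k \in [set k : int | 1 <= k]) \fsum_(n \in [set n : int | 0 <= n])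
       ((1 - z ^ (k - 1)) * (1 - z ^ k) * z ^ (1 - k) * (-1) ^ (k + 1)
        * q ^ ((k * (k - 1) %/ 2)%Z + (n * (3 * n - 1) %/ 2)%Z + 3 * k * n)
        * (1 - q ^ (2 * k - 1)) * (1 - q ^ (k + n))))
  /\
  (* C5 *)
  ((1 + z) * qpoch2_inf z z^-1 q * S_C5 z q =
     \fsum_(k \in [set: int])
       ((1 - z ^ (k - 1)) * (1 - z ^ k) * z ^ (1 - k) * (-1) ^ k
        * q ^ (k ^+ 2)))
  /\
  (* E2 *)
  ((1 + z) * qpoch2_inf z z^-1 q * S_E2 z q =
     qpoch_inf q (q ^+ 2) *
     \fsum_(k \in [set k : int | 1 <= k])
       ((1 - z ^ k) * (1 - z ^ (k - 1)) * z ^ (1 - k)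
        * q ^ (k * (k - 1) %/ 2)%Z))
  /\
  (* E4 *)
  ((1 + z) * qpoch2_inf z z^-1 q * S_E4 z q =
     (qpoch_inf q q)^-1 *
     \fsum_(k \in [set k : int | 1 <= k]) \fsum_(n \in [set n : int | 0 <= n])
       ((1 - z ^ (k - 1)) * (1 - z ^ k) * z ^ (1 - k) * (-1) ^ (k + n + 1)
        * q ^ ((k * (k + 1) %/ 2)%Z + n ^+ 2 - n + 2 * k * n - 1)
        * (1 - q ^ (2 * n + 1)))).
Proof.
have U := zser_unit.
split; [exact: identity_A1 | split; [exact: identity_A3 | split; [exact: identity_A5 |]]].
split; [exact: identity_A7 | split; [exact: identity_C1 | split; [exact: identity_C5 |]]].
by split; [exact: identity_E2 | exact: identity_E4].
Qed.
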